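(* Let $g\ge 0$, $m>0$, $d>0$ be integers, let $\beta=(\beta_1,\ldots,\beta_n)=[1^{a_1},2^{a_2},\ldots,d^{a_d}]\vdash d$, and let $t=2g+n-1+m-d$ (assumed $\ge 0$). Put $c_1=a_1-1$ and $c_i=a_i$ for $1<i\le d$. Then $$\mathsf{H}^g_{d,m}(\beta)=t!\,d^{t-1}\,[y^{2g+m-d}]\left.\left\{\frac{\partial^d}{\partial x^d}\,x^{\frac{d-1}{2}}\cdot\frac{(\log x)^m}{m!}\cdot\prod_{i=1}^d\left(\frac{\sinh(\frac{i}{2}\log x+\frac{i}{2}y)}{iy/2}\right)^{c_i}\right\}\right|_{x=1}.$$
   Context: For a partition $\beta\vdash d$ written as $[1^{a_1},\ldots,d^{a_d}]$ ($a_i$ parts equal to $i$), with $n=\ell(\beta)$ parts, let $\mathrm{Aut}(\beta)=\prod_i a_i!$. For integers $g\ge 0$, $m>0$ with $t=2g-1+n+m-d\ge 0$, the one-part quasi-triple Hurwitz number is $$\mathsf{H}^g_{d,m}(\beta)=\frac{\mathrm{Aut}(\beta)}{d!}\,N,$$ where $N$ is the number of tuples $(\sigma_0,\tau_1,\ldots,\tau_t,\sigma_{t+1})$ in $\mathfrak{S}_d$ with $\sigma_0$ a $d$-cycle, each $\tau_i$ a transposition, $\sigma_{t+1}$ of cycle type $\beta$, and $\sigma_0\tau_1\cdots\tau_t\sigma_{t+1}$ having exactly $m$ cycles. $[y^k]F$ denotes the coefficient of $y^k$ in $F$; the expression in braces is regarded as a Laurent series in $y$ whose coefficients are functions of $x$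 analytic near $x=1$, and $\sinh u=(e^u-e^{-u})/2$. *)

(* Defs.v *)
From Stdlib Require Import Reals.
From Coquelicot Require Import Coquelicot.
From mathcomp Require Import all_boot fingroup perm.

Set Implicit Arguments.
Unset Strict Implicit.
Unset Printing Implicit Defensive.

(* A partition beta of d is represented by the (multi)list of its parts;
   all parts positive, summing to d.  a_i = multiplicity of i in beta. *)
Definition mult (beta : seq nat) (i : nat) : nat := count (pred1 i) beta.

Definition Aut (beta : seq nat) : nat :=
  \prod_(1 <= i < (sumn beta).+1) (mult beta i)`!.

(* s has cycle type beta: for every length i, the number of cycles of s of
   length i equals the multiplicity of i in beta (beta has positive parts
   summing to d, so this is the full cycle type). *)
Definition has_cycle_type (d : nat) (s : {perm 'I_d}) (beta : seq nat) : bool :=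
  [forall i : 'I_d.+1,
     #|[set X in porbits s | #|X| == i]| == mult beta i].

Definition is_transposition (d : nat) (s : {perm 'I_d}) : bool :=
  [exists x : 'I_d, exists y : 'I_d, (x != y) && (s == tperm x y)].

Definition is_full_cycle (d : nat) (s : {perm 'I_d}) : bool :=
  has_cycle_type s [:: d].

Definition hurwitz_count (d t m : nat) (beta : seq nat) : nat :=
  #|[set p : {perm 'I_d} * {ffun 'I_t -> {perm 'I_d}} * {perm 'I_d} |
      [&& is_full_cycle p.1.1,
          [forall j, is_transposition (p.1.2 j)],
          has_cycle_type p.2 beta &
          #|porbits (p.1.1 * (\prod_(j < t) p.1.2 j) * p.2)%g| == m]]|.

(* One-part quasi-triple Hurwitz number H^g_{d,m}(beta), with
   n = size beta and t = 2g - 1 + n + m - d (assumed >= 0 by the caller). *)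
Definition hurwitzH (g d m : nat) (beta : seq nat) : R :=
  let t := (2 * g + size beta + m - 1 - d)%nat in
  (INR (Aut beta) / INR (d`!) * INR (hurwitz_count d t m beta)).

Open Scope R_scope.

Definition Cexp (z : C) : C :=
  (exp (Re z) * cos (Im z), exp (Re z) * sin (Im z)).
Definition Csinh (z : C) : C := Cmult (Cminus (Cexp z) (Cexp (Copp z))) (RtoC (/ 2)).

Definition Cpowz (z : C) (n : Z) : C :=
  match n with
  | Z0 => RtoC 1
  | Zpos p => pow_n z (Pos.to_nat p)
  | Zneg p => Cinv (pow_n z (Pos.to_nat p))
  end.

Definition cexp (beta : seq nat) (i : nat) : Z :=
  if i == 1%nat then (Z.of_nat (mult beta 1) - 1)%Z else Z.of_nat (mult beta i).

Definition Fbrace (d m : nat) (beta : seq nat) (x : R) (y : C) : C :=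
  Cmult (RtoC (Rpower x ((INR d - 1) / 2) * (ln x) ^ m / INR (m`!)))
    (foldr Cmult (RtoC 1)
       [seq Cpowz
          (Cdiv (Csinh (Cplus (RtoC (INR i / 2 * ln x)) (Cmult (RtoC (INR i / 2)) y)))
                (Cmult (RtoC (INR i / 2)) y))
          (cexp beta i) | i <- iota 1 d]).

(* [y^k] of the Laurent expansion of y |-> F(x,y) on the circle |y| = r:
   (1/(2 pi i)) \oint_{|y|=r} F(x,y) y^{-k-1} dy
     = (1/(2 pi)) \int_0^{2 pi} F(x, r e^{i theta}) (r e^{i theta})^{-k} d theta.
   Split into real and imaginary parts. *)
Definition circ_integrand (d m : nat) (beta : seq nat) (r : R) (k : Z)
    (x theta : R) : C :=
  let y : C := (r * cos theta, r * sin theta) in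
  Cmult (Fbrace d m beta x y) (Cpowz y (- k)).

Definition laurent_coef_Re (d m : nat) (beta : seq nat) (r : R) (k : Z) (x : R) : R :=
  / (2 * PI) * RInt (fun th => Re (circ_integrand d m beta r k x th)) 0 (2 * PI).

Definition laurent_coef_Im (d m : nat) (beta : seq nat) (r : R) (k : Z) (x : R) : R :=
  / (2 * PI) * RInt (fun th => Im (circ_integrand d m beta r k x th)) 0 (2 * PI).

(* Main.v *)
Require Import Defs.
From Stdlib Require Import Reals Lra.
From Coquelicot Require Import Coquelicot.
From HB Require Import structures.
From mathcomp Require Import all_boot all_algebra fingroup perm.
From mathcomp Require Import Rstruct zify.
From mathcomp Require ring.

(** For an (S, R) pair of subsets meeting in one point and covering [d], the
    element A_S B_R (A_S the signed sum of Sym S, B_R the sum of Sym R) is an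
    eigenvector of every class function acting by convolution, because
    A_S g B_R vanishes unless g lies in Sym S Sym R.  For the class function
    u^(number of cycles) and |S| = k + 1 the eigenvalue is
    prod_(j < d) (u + d - 1 - k - j); its coefficient of u^(d-1) is the eigenvalue
    d (d - 1 - 2k) / 2 of the sum of transpositions.  Summing A_S B_R over all
    pairs with weight (-z)^k gives d prod_C (1 - z^|C|) / (1 - z), C ranging
    over the cycles of the permutation, whose value at z = 1 is d^2 on d-cycles
    and 0 elsewhere.  Hence, with Q = prod_i (1 - z^beta_i) / (1 - z),

      d N = |class of beta| sum_k Q_k (d a_k)^t [u^m] prod_(j < d) (u + d-1-k-j),

    where a_k = (d - 1 - 2k) / 2.  On the analytic side, the product of the
    sinh is up to the factor y^(n-1) prod beta_i the exponential polynomial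
    sum_k Q_k (x e^y)^(a_k), so that the pole at y = - log x cancels, the
    contour integral extracts a_k^t / t!, and the d-th derivative of
    x^(d-1-k) (log x)^m / m! at 1 is [u^m] prod_(j < d) (u + d-1-k-j). *)

Set Implicit Arguments.
Unset Strict Implicit.
Unset Printing Implicit Defensive.

Import GRing.Theory Num.Theory.

(** * Signed sums over products of symmetric groups *)

Section HookIdempotents.

Variable T : finType.
Implicit Types (U S R : {set T}) (g s r : {perm T}).
Local Open Scope group_scope.

Lemma perm_on_sub S R s : S \subset R -> perm_on S s -> perm_on R s.
Proof. by move=> sSR sS; apply: subset_trans sSR. Qed.

Lemma tperm_in_Sym S x y : x \in S -> y \in S -> tperm x y \in Sym S.
Proof.
move=> xS yS; rewrite inE; apply: perm_on_sub (tperm_on x y).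
by apply/subsetP=> z /set2P[]->.
Qed.

(** Coset decomposition of [Sym (b |: U)] over [Sym U]: the permutations sending b to c form the
    coset of [tperm b c], since composing with this transposition makes b fixed again. *)
Lemma Sym_insert U b c s : b \notin U -> c \in b |: U ->
  (s * tperm b c \in Sym (b |: U)) && ((s * tperm b c) b == c) = (s \in Sym U).
Proof.
move=> bU cU; have bbU : b \in b |: U by rewrite setU11.
apply/andP/idP=> [[stS /eqP stb]|sS].
  have sS : s \in Sym (b |: U).
    by rewrite -(groupMr _ (tperm_in_Sym bbU cU)).
  have sb : s b = b.
    by apply: (@perm_inj _ (tperm b c)); rewrite tpermL -[RHS]stb permM.
  rewrite inE; apply/subsetP=> x; rewrite !inE => sx.
  move: sS; rewrite inE => /subsetP /(_ x); rewrite !inE => /(_ sx).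
  by case/orP=> // /eqP exb; rewrite exb sb eqxx in sx.
split; last by move: sS; rewrite inE => sS; rewrite permM (out_perm sS bU) tpermL.
apply: groupM; last exact: tperm_in_Sym.
by move: sS; rewrite !inE; apply: perm_on_sub; rewrite subsetUr.
Qed.

Lemma big_Sym_insert (V : Type) (idx : V) (op : Monoid.com_law idx) U b
    (F : {perm T} -> V) : b \notin U ->
  \big[op/idx]_(s in Sym (b |: U)) F s =
  \big[op/idx]_(s in Sym U) \big[op/idx]_(c in b |: U) F (s * tperm b c).
Proof.
move=> bU; rewrite exchange_big /=.
rewrite (partition_big (fun s : {perm T} => s b) (mem (b |: U))) /=; last first.
  by move=> s; rewrite inE => sS; rewrite (perm_closed _ sS) setU11.
apply: eq_bigr => c cU.
rewrite (reindex_inj (mulIg (tperm b c))).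
by apply: eq_bigl => s; rewrite Sym_insert.
Qed.

Lemma sum_Sym_insert (V : zmodType) U b (F : {perm T} -> V) : b \notin U ->
  (\sum_(s in Sym (b |: U)) F s =
   \sum_(s in Sym U) \sum_(c in b |: U) F (s * tperm b c)%g)%R.
Proof. exact: big_Sym_insert. Qed.

Lemma sum_Sym_insertl (V : zmodType) U b (F : {perm T} -> V) : b \notin U ->
  (\sum_(s in Sym (b |: U)) F s =
   \sum_(s in Sym U) \sum_(c in b |: U) F (tperm b c * s)%g)%R.
Proof.
move=> bU; rewrite (reindex_inj invg_inj) /=.
rewrite (eq_bigl (mem (Sym (b |: U)))) => [|s]; last by rewrite groupV.
rewrite sum_Sym_insert // [RHS](reindex_inj invg_inj) /=.
apply: eq_big => [s|s _]; first by rewrite groupV.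
by apply: eq_bigr => c _; rewrite invMg tpermV.
Qed.

Variable K : comPzRingType.
Local Open Scope ring_scope.

Definition psign s : K := (-1) ^+ s.

Lemma psignM s r : psign (s * r)%g = psign s * psign r.
Proof. by rewrite /psign odd_permM signr_addb. Qed.

Lemma psignV s : psign s^-1%g = psign s.
Proof. by rewrite /psign odd_permV. Qed.

Lemma psign_tperm x y : x != y -> psign (tperm x y) = -1.
Proof. by move=> xy; rewrite /psign odd_tperm xy. Qed.

(* The coefficient at [h] of the element
   (sum of the signed permutations of S) g (sum of the permutations of R)
   of the group algebra. *)
Definition AgB S R g h : K :=
  \sum_(s in Sym S) \sum_(r in Sym R) psign s *+ (h == s * g * r)%g.

Definition AB S R h : K := AgB S R 1%g h.

Lemma AgB_mull S R s0 g h : s0 \in Sym S ->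
  AgB S R (s0 * g)%g h = psign s0 * AgB S R g h.
Proof.
move=> s0S; rewrite /AgB (reindex_inj (mulIg s0^-1%g)) /= mulr_sumr.
apply: eq_big => [s|s _]; first by rewrite groupMr ?groupV.
rewrite mulr_sumr; apply: eq_bigr => r _.
by rewrite !mulgA mulgKV psignM psignV mulrnAr mulrC.
Qed.

Lemma AgB_mulr S R r0 g h : r0 \in Sym R -> AgB S R (g * r0)%g h = AgB S R g h.
Proof.
move=> r0R; rewrite /AgB; apply: eq_bigr => s _.
rewrite (reindex_inj (mulgI r0^-1%g)) /=.
apply: eq_big => [r|r _]; first by rewrite groupMl ?groupV.
by rewrite !mulgA mulgK.
Qed.

(** If 1 = s r then s = r^-1 moves only common points of S and R, and a permutation moving at most
    one point is the identity; only the term s = r = 1 is left. *)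
Lemma AB1 S R : (#|S :&: R| <= 1)%N -> AB S R 1%g = 1.
Proof.
move=> SR1; rewrite /AB /AgB (bigD1 1%g) ?group1 //= (bigD1 1%g) ?group1 //=.
have key s r : s \in Sym S -> r \in Sym R -> (1 == s * 1 * r)%g -> s = 1%g.
  move=> sS rR; rewrite mulg1 => /eqP e.
  have esr : s = r^-1%g by apply: (mulIg r); rewrite mulVg -e.
  apply: (@perm_on_id _ _ (S :&: R)) => //.
  have sR : perm_on R s by have : s \in Sym R by [rewrite esr groupV]; rewrite inE.
  move: sS; rewrite inE => sS; apply/subsetP=> x xs; rewrite inE.
  by rewrite (subsetP sS) ?(subsetP sR).
rewrite !mulg1 eqxx big1 => [|r /andP[rR r1]]; last first.
  by rewrite !mul1g [_ == r]eq_sym (negbTE r1).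
rewrite big1 => [|s /andP[sS s1]]; last first.
  apply: big1 => r rR; case: eqP => // e.
  by case/eqP: s1; apply: (key s r) => //; apply/eqP.
by rewrite /psign odd_perm1 !addr0.
Qed.

End HookIdempotents.

Arguments AB {T K}.
Arguments AgB {T K}.

(** * Von Neumann's lemma for hook-shaped pairs *)

Section VonNeumann.

Variables (T : finType) (K : numDomainType).
Implicit Types (U S R : {set T}) (g s r : {perm T}).
Local Open Scope ring_scope.

(** Products act from left to right, so s has to follow g on S. It does, except that the one point
    of S that g may carry into R is sent to the common point a. *)
Lemma hook_factor S R a g : S :|: R = setT -> S :&: R = [set a] ->
    {in S &, forall x y, g x \in R -> g y \in R -> x = y} ->
  exists2 s, s \in Sym S & exists2 r, r \in Sym R & g = (s * r)%g.
Proof.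
move=> ST SR1 inj.
have /setIP[aS aR] : a \in S :&: R by rewrite SR1 set11.
have SorR x : (x \in S) || (x \in R) by rewrite -in_setU ST inE.
have SandR x : x \in S -> x \in R -> x = a.
  by move=> xS xR; apply/set1P; rewrite -SR1 inE xS.
pose f x := if x \in S then (if g x \in R then a else g x) else x.
have f_inj : injective f.
  move=> x y; rewrite /f.
  have [xS|xS] := boolP (x \in S); have [yS|yS] := boolP (y \in S) => //.
  - have [gx|gx] := boolP (g x \in R); have [gy|gy] := boolP (g y \in R).
    + by move=> _; apply: inj.
    + by move=> e; rewrite -e aR in gy.
    + by move=> e; rewrite e aR in gx.
    + exact: perm_inj.
  - have [gx|gx] := boolP (g x \in R) => e; first by rewrite -e aS in yS.
    by have := SorR (g x); rewrite (negbTE gx) e (negbTE yS).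
  - have [gy|gy] := boolP (g y \in R) => e; first by rewrite e aS in xS.
    by have := SorR (g y); rewrite (negbTE gy) -e (negbTE xS).
pose s := perm f_inj.
have sS : s \in Sym S.
  rewrite inE; apply/subsetP=> x; rewrite inE permE /f.
  by case: ifP; rewrite ?eqxx.
exists s => //; exists (s^-1 * g)%g; last by rewrite mulKVg.
rewrite inE; apply/subsetP=> y; rewrite inE => sgy.
case: (boolP (y \in R)) => // yR; case/eqP: sgy.
(* At most one point of S is missing from P, so P has at least as many points as the complement of
   R, which is S without a. Hence [g @: P] fills that complement, and g and s agree on P. *)
pose P := [set x in S | g x \notin R].
have cardP : (#|~: R| <= #|P|)%N.
  have -> : ~: R = S :\ a.
    apply/setP=> x; rewrite !inE; have := SorR x; have := SandR x.
    case: (boolP (x \in R)) => xR; case: (boolP (x \in S)) => xS //=.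
    + by move=> /(_ isT isT)->; rewrite eqxx.
    + by rewrite andbF.
    + by move=> _ _; case: eqP => // e; rewrite e aR in xR.
  have: (#|S :\: P| <= 1)%N.
    rewrite leqNgt; apply/negP=> /card_gt1P[x [y' [+ + xy]]].
    rewrite !inE; case: (boolP (x \in S)) => //= xS.
    case: (boolP (y' \in S)) => //= yS.
    rewrite !andbT !negbK => gx gy; case/eqP: xy; exact: inj.
  have PS : P \subset S by apply/subsetP=> x; rewrite inE => /andP[].
  by rewrite cardsD (setIidPr PS) [#|S|](cardsD1 a S) aS; lia.
have : y \in g @: P.
  have /eqP-> : g @: P == ~: R; last by rewrite inE.
  rewrite eqEcard card_imset ?cardP ?andbT; last exact: perm_inj.
  by apply/subsetP=> _ /imsetP[x + ->]; rewrite !inE => /andP[].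
case/imsetP=> x; rewrite inE => /andP[xS gx] ->.
have -> : g x = s x by rewrite permE /f xS (negbTE gx).
by rewrite permM permK permE /f xS (negbTE gx).
Qed.

(** The alternative behind Young symmetrizers: either g carries two points of S into R and the
    product vanishes, or g = s r and both factors are absorbed up to the sign of s. The scalar is
    read off at 1, where [AB] has value 1. *)
Lemma AgB_scalar S R a g h : S :|: R = setT -> S :&: R = [set a] ->
  AgB S R g h = AgB S R g 1%g * AB S R h :> K.
Proof.
move=> ST SR1.
have AB11 : AB S R 1%g = 1 :> K by rewrite AB1 // SR1 cards1.
case: (boolP [exists x in S, exists y in S, [&& x != y, g x \in R & g y \in R]]).
  case/exists_inP=> x xS /exists_inP[y yS /and3P[xy gx gy]].
  (* a transposition of S that [g] carries into R makes A g B equal to its opposite *)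
  suff z h' : AgB S R g h' = 0 :> K by rewrite !z mul0r.
  have eg : (tperm x y * g = g * tperm (g x) (g y))%g.
    by rewrite -tpermJ conjgE !mulgA mulgV mul1g.
  have: AgB S R (tperm x y * g)%g h' = - AgB S R g h' :> K.
    by rewrite AgB_mull ?tperm_in_Sym // psign_tperm // mulN1r.
  rewrite eg AgB_mulr ?tperm_in_Sym // => /eqP.
  by rewrite eq_sym eqNr => /eqP.
rewrite negb_exists_in => /forall_inP noxy.
have [x y xS yS gx gy|s sS [r rR ->]] := @hook_factor S R a g ST SR1.
  apply/eqP; apply: contraT => xy; have := noxy x xS.
  by rewrite negb_exists_in => /forall_inP/(_ y yS); rewrite xy gx gy.
have e h' : AgB S R (s * r)%g h' = psign K s * AB S R h'.
  by rewrite AgB_mull // -[r]mul1g AgB_mulr.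
by rewrite !e AB11 mulr1.
Qed.

(** A class function commutes with A, so its product with A B is the sum of the psi(g) A g B, each a
    multiple of A B by [AgB_scalar]. The eigenvalue is the value of that product at 1. *)
Lemma AB_eigen S R a (psi : {perm T} -> K) h :
    S :|: R = setT -> S :&: R = [set a] ->
    (forall g s, psi (g ^ s)%g = psi g) ->
  \sum_g psi g * AB S R (g^-1 * h)%g =
  (\sum_(s in Sym S) \sum_(r in Sym R) psign K s * psi (s * r)^-1%g) * AB S R h.
Proof.
move=> ST SR1 psiJ.
have key h' : \sum_g psi g * AB S R (g^-1 * h')%g = \sum_g psi g * AgB S R g h'.
  under eq_bigr do rewrite mulr_sumr.
  under [RHS]eq_bigr do rewrite mulr_sumr.
  rewrite exchange_big [RHS]exchange_big /=; apply: eq_bigr => s _.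
  rewrite (reindex_inj (conjg_inj s^-1%g)) /=; apply: eq_bigr => g _.
  rewrite psiJ; congr (_ * _); apply: eq_bigr => r _; congr (_ *+ _).
  congr nat_of_bool; rewrite mulg1 conjgE invgK -!mulgA.
  by rewrite -(inj_eq (mulgI (s * (g * s^-1))%g)) mulKVg !mulgA mulgKV.
rewrite key; under eq_bigr do rewrite (AgB_scalar _ _ ST SR1) mulrA.
rewrite -mulr_suml -key; congr (_ * _).
under eq_bigr do rewrite mulr_sumr.
rewrite exchange_big /=; apply: eq_bigr => s _.
under eq_bigr do rewrite mulr_sumr.
rewrite exchange_big /=; apply: eq_bigr => r _.
rewrite (bigD1 (s * r)^-1%g) //= invgK !mulg1 eqxx big1 ?addr0 1?mulrC // => g ne.
rewrite !mulg1; case: eqP => [e|_]; last by rewrite mulr0n mulr0.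
by rewrite -e invgK eqxx in ne.
Qed.

End VonNeumann.

(** * The hook polynomial *)

Section HookPoly.

Variables (T : finType) (K : numDomainType).
Implicit Types (U S R : {set T}) (g h s r : {perm T}).
Local Open Scope ring_scope.

(** Here S = a |: U and R is the complement of U, so that a is their common point and #|U| is the
    leg length k of the hook. *)
Definition hookpoly h : {poly K} :=
  \sum_(U : {set T}) \sum_(a in ~: U) (- 'X) ^+ #|U| * (AB (a |: U) (~: U) h)%:P.

Lemma AB_insertl U R a h : a \notin U ->
  AB (a |: U) R h = AB U R h - \sum_(c in U) AgB U R (tperm a c) h :> K.
Proof.
move=> aU; rewrite {1}/AB /AgB sum_Sym_insert //.
under eq_bigr do rewrite big_setU1 //=.
rewrite big_split /=; congr (_ + _).
  by rewrite tperm1; under eq_bigr do rewrite mulg1.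
rewrite exchange_big -sumrN /=; apply: eq_bigr => c cU.
rewrite -sumrN; apply: eq_bigr => s _.
rewrite -sumrN; apply: eq_bigr => r _.
have ac : a != c by apply: contraNneq aU => ->.
by rewrite mulg1 psignM psign_tperm // mulrN1 mulNrn.
Qed.

Lemma AB_insertr S R a h : a \notin R ->
  AB S (a |: R) h = AB S R h + \sum_(c in R) AgB S R (tperm a c) h :> K.
Proof.
move=> aR; rewrite {1}/AB /AgB.
under eq_bigr do rewrite sum_Sym_insertl // exchange_big /= big_setU1 //=.
rewrite big_split /=; congr (_ + _).
  by rewrite tperm1; under eq_bigr do under eq_bigr do rewrite mul1g.
rewrite exchange_big /=; apply: eq_bigr => c cR.
apply: eq_bigr => s _; apply: eq_bigr => r _.
by rewrite mulg1 mulgA.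
Qed.

Lemma sum_set_insert (V : zmodType) (F : {set T} -> T -> V) :
  \sum_(U : {set T}) \sum_(a in ~: U) F U a =
  \sum_(S : {set T}) \sum_(a in S) F (S :\ a) a.
Proof.
rewrite pair_big_dep [RHS]pair_big_dep /=.
rewrite (reindex_onto (fun p : {set T} * T => (p.1 :\ p.2, p.2))
                      (fun p : {set T} * T => (p.2 |: p.1, p.2))) /=.
  apply: eq_bigl => [[S a]] /=; rewrite !inE eqxx /= xpair_eqE eqxx andbT /=.
  apply/eqP/idP => [<-|aS]; first by rewrite setU11.
  by rewrite setD1K.
move=> [U a] /=; rewrite inE => aU; congr (_, _).
by rewrite setU1K.
Qed.

(* Each A_(a|:U) B_(~:U) is expanded along A in [hookpoly] and along B
   in [- 'X * hookpoly]; the terms with a transposition across U and ~:U cancel. *)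
Lemma hookpoly_mul h :
  (1 - 'X) * hookpoly h =
  #|T|%:R * \sum_(S : {set T}) (- 'X) ^+ #|S| * (AB S (~: S) h)%:P.
Proof.
rewrite mulrBl mul1r.
have -> : 'X * hookpoly h =
    - \sum_(S : {set T}) \sum_(a in S) (- 'X) ^+ #|S| *
        (AB S (~: S) h + \sum_(c in ~: S) AgB S (~: S) (tperm a c) h)%:P.
  rewrite /hookpoly sum_set_insert mulr_sumr -sumrN; apply: eq_bigr => S _.
  rewrite mulr_sumr -sumrN; apply: eq_bigr => a aS.
  rewrite setD1K // setCD setUC AB_insertr ?inE ?aS //.
  by rewrite [in RHS](cardsD1 a S) aS exprS -mulrA mulNr opprK.
rewrite opprK /hookpoly.
have -> : \sum_(U : {set T}) \sum_(a in ~: U)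
      (- 'X) ^+ #|U| * (AB (a |: U) (~: U) h)%:P =
    \sum_(U : {set T}) \sum_(a in ~: U) (- 'X) ^+ #|U| *
        (AB U (~: U) h - \sum_(c in U) AgB U (~: U) (tperm c a) h)%:P :> {poly K}.
  apply: eq_bigr => U _; apply: eq_bigr => a; rewrite inE => aU.
  by rewrite AB_insertl //; under [in RHS]eq_bigr do rewrite tpermC.
rewrite -big_split mulr_sumr /=; apply: eq_bigr => S _.
rewrite -!mulr_sumr -mulrDr mulrCA; congr (_ * _).
rewrite -!rmorph_sum -rmorphD /= -[#|T|%:R](rmorph_nat polyC) -rmorphM; congr (_%:P).
(* The two sums over transpositions agree after exchanging the order of summation; [AB] is counted
   #|~: S| times in one part and #|S| times in the other, hence #|T| times in all. *)
rewrite sumrB big_split /= !sumr_const [X in _ - X]exchange_big /=.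
rewrite -addrA [- _ + _]addrC -addrA addrN addr0 -mulrnDr mulr_natl.
by rewrite addnC cardsC.
Qed.

End HookPoly.

(** * The cycles of a permutation as a partition *)

Section Orbits.

Local Open Scope nat_scope.

Variables (T : finType).
Implicit Types (U S R : {set T}) (g h s r t : {perm T}).

Lemma porbit_stable s x y : y \in porbit s x -> s y \in porbit s x.
Proof. by rewrite -!eq_porbit_mem => /eqP<-; rewrite eq_porbit_mem (mem_porbit s 1). Qed.

Lemma porbit_sub s S x : s @: S \subset S -> x \in S -> porbit s x \subset S.
Proof.
move=> /subsetP sS xS; apply/subsetP=> _ /porbitP[i ->].
elim: i => [|i IH]; first by rewrite expg0 perm1.
by rewrite expgSr permM sS ?imset_f.
Qed.

Lemma porbit_eq s t x : {in porbit s x, t =1 s} -> porbit t x = porbit s x.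
Proof.
move=> ts.
have e i : (t ^+ i)%g x = (s ^+ i)%g x.
  elim: i => [|i IH]; first by rewrite !expg0.
  by rewrite !expgSr !permM IH ts ?mem_porbit.
by apply/setP=> y; apply/porbitP/porbitP=> -[i ->]; exists i.
Qed.

Lemma porbit_fixed s x : s x = x -> porbit s x = [set x].
Proof.
move=> sx; apply/setP=> y; rewrite inE; apply/porbitP/eqP => [[i ->]|->].
  exact: permX_fix.
by exists 0%N; rewrite expg0 perm1.
Qed.

Lemma mem_porbits s x X : X \in porbits s -> x \in X -> X = porbit s x.
Proof. by move=> /imsetP[y _ ->]; rewrite -eq_porbit_mem => /eqP. Qed.

Lemma porbit_in s x : porbit s x \in porbits s.
Proof. exact: imset_f. Qed.

Lemma porbits_neq0 s X : X \in porbits s -> exists x, x \in X.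
Proof. by case/imsetP=> x _ ->; exists x; apply: porbit_id. Qed.

Lemma trivIset_porbits s (A : {set {set T}}) : A \subset porbits s -> trivIset A.
Proof.
move=> /subsetP As; apply/trivIsetP=> X Y XA YA; apply: contraNT.
case/pred0Pn=> x /= /andP[xX xY].
by rewrite (mem_porbits (As _ XA) xX) (mem_porbits (As _ YA) xY).
Qed.

Lemma cover_porbits s : cover (porbits s) = setT.
Proof.
apply/setP=> x; rewrite inE; apply/bigcupP; exists (porbit s x); first exact: porbit_in.
exact: porbit_id.
Qed.

Lemma sum_card_porbits s : \sum_(X in porbits s) #|X| = #|T|.
Proof.
rewrite -cardsT -(cover_porbits s); apply/eqP; exact: (trivIset_porbits (subxx _)).
Qed.

End Orbits.

(** * The hook polynomial in terms of cycles *)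

Section CycleProduct.

Variables (T : finType) (K : numDomainType).
Implicit Types (U S R : {set T}) (g h s r t : {perm T}).
Local Open Scope ring_scope.

Lemma AB_mull S R s h : s \in Sym S ->
  AB S R (s * h)%g = psign K s * AB S R h.
Proof.
move=> sS; rewrite /AB /AgB (reindex_inj (mulgI s)) /= mulr_sumr.
apply: eq_big => [g|g _]; first by rewrite groupMl.
rewrite mulr_sumr; apply: eq_bigr => r _.
by rewrite -!mulgA (inj_eq (mulgI s)) psignM mulrnAr.
Qed.

Lemma AB_mulr S R r h : r \in Sym R -> AB S R (h * r)%g = AB S R h :> K.
Proof.
move=> rR; rewrite /AB /AgB; apply: eq_bigr => s _.
rewrite (reindex_inj (mulIg r)) /=.
apply: eq_big => [g|g _]; first by rewrite groupMr.
by rewrite !mulgA (inj_eq (mulIg r)).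
Qed.

Lemma AB_unstable S h : h @: S != S -> AB S (~: S) h = 0 :> K.
Proof.
move=> hS; rewrite /AB /AgB big1 // => s; rewrite inE => sS.
apply: big1 => r; rewrite inE => rS; case: eqP => // e; case/eqP: hS.
rewrite e mulg1; apply/setP=> x; apply/imsetP/idP => [[y yS ->]|xS].
  by rewrite permM (out_perm rS) ?inE ?negbK (perm_closed _ sS).
exists (s^-1%g x); first by rewrite (perm_closed _ (perm_onV sS)).
by rewrite permM permKV (out_perm rS) ?inE ?negbK.
Qed.

(** On a stable S, h = s r with s the restriction of h to S, so [AB] is the sign of s. The parity of
    s is that of #|T| minus its number of cycles, and s has the cycles of h inside S together with
    #|~: S| fixed points. *)
Lemma AB_stable S h : h @: S = S ->
  (-1) ^+ #|S| * AB S (~: S) h = (-1) ^+ #|[set X in porbits h | X \subset S]| :> K.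
Proof.
move=> hS.
have hSE x : (h x \in S) = (x \in S).
  by rewrite -{1}hS mem_imset //; apply: perm_inj.
pose f x := if x \in S then h x else x.
have f_inj : injective f.
  move=> x y; rewrite /f; case: (boolP (x \in S)) => xS; case: (boolP (y \in S)) => yS //.
  - exact: perm_inj.
  - by move=> e; rewrite -e hSE xS in yS.
  - by move=> e; rewrite e hSE yS in xS.
pose s := perm f_inj.
have sE x : s x = if x \in S then h x else x by rewrite permE.
have sS : s \in Sym S.
  by rewrite inE; apply/subsetP=> x; rewrite inE sE; case: ifP; rewrite ?eqxx.
pose r := (s^-1 * h)%g.
have rS : r \in Sym (~: S).
  rewrite inE; apply/subsetP=> x; rewrite !inE permM; apply: contraNN.
  rewrite -{1 3}[x](permKV s); move: (s^-1%g x) => y; rewrite sE.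
  by case: (boolP (y \in S)) => // /negbTE ->.
have -> : h = (s * (1 * r))%g by rewrite mul1g mulKVg.
rewrite AB_mull // AB_mulr // AB1 ?setICr ?cards0 // mulr1 mul1g mulKVg.
have -> : #|[set X in porbits h | X \subset S]| = (#|porbits s| - #|~: S|)%N.
  have -> : porbits s = [set X in porbits h | X \subset S] :|: [set [set x] | x in ~: S].
    apply/setP=> X; rewrite !inE; apply/idP/idP.
      case/imsetP=> x _ ->; case: (boolP (x \in S)) => xS.
        have e : porbit s x = porbit h x.
          apply: porbit_eq => y /(subsetP (porbit_sub _ xS)) yS.
          by rewrite sE yS // hS.
        by rewrite e porbit_in porbit_sub // hS.
      rewrite porbit_fixed; last by rewrite sE (negbTE xS).
      by apply/orP; right; apply: imset_f; rewrite inE.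
    case/orP=> [/andP[/imsetP[x _ ->] /subsetP xS]|/imsetP[x + ->]].
      rewrite -(@porbit_eq _ h s x) ?porbit_in // => y /xS yS.
      by rewrite sE yS.
    by rewrite inE => xS; rewrite -(@porbit_fixed _ s x) ?porbit_in // sE (negbTE xS).
  rewrite cardsU (_ : _ :&: _ = set0) ?cards0 ?subn0; last first.
    apply/setP=> X; rewrite !inE; apply/negP=> /andP[/andP[_ /subsetP XS] /imsetP[x]].
    by rewrite inE => xS eX; case/negP: xS; apply: XS; rewrite eX set11.
  by rewrite (card_imset _ set1_inj) addnK.
have le : (#|~: S| <= #|porbits s|)%N.
  rewrite -(card_imset (~: S) set1_inj); apply/subset_leq_card/subsetP=> _ /imsetP[x + ->].
  by rewrite inE => xS; rewrite -(@porbit_fixed _ s x) ?porbit_in // sE (negbTE xS).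
rewrite /psign -signr_odd -[in RHS]signr_odd -signr_addb; congr (_ ^+ (nat_of_bool _)).
rewrite oddB // /odd_perm -(cardsC S) oddD.
by case: (odd #|S|); case: (odd #|~: S|); case: (odd #|porbits s|).
Qed.

Lemma prod_1B_subset (I : finType) (P : {set I}) (F : I -> {poly K}) :
  \prod_(i in P) (1 - F i) = \sum_(A : {set I} | A \subset P) \prod_(i in A) - F i.
Proof.
rewrite big_mkcond /=.
have -> : \prod_i (if i \in P then 1 - F i else 1) =
          \prod_i ((if i \in P then - F i else 0) + 1).
  by apply: eq_bigr => i _; case: ifP; rewrite ?add0r // addrC.
rewrite bigA_distr /= [RHS]big_mkcond /=; apply: eq_bigr => A _.
case: (boolP (A \subset P)) => [/subsetP AP|/subsetPn[i iA iP]].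
  by rewrite [RHS]big_mkcond; apply: eq_bigr => i _; case: ifP => // /AP->.
by rewrite (bigD1 i) //= iA (negbTE iP) mul0r.
Qed.

(** Only unions of cycles of h contribute, each with the product of the -X^|C| over its cycles C;
    this is the expansion of the right side over sets of cycles. *)
Lemma sum_AB_cycles h :
  \sum_(S : {set T}) (- 'X) ^+ #|S| * (AB S (~: S) h)%:P =
  \prod_(X in porbits h) (1 - 'X^#|X|) :> {poly K}.
Proof.
rewrite prod_1B_subset.
rewrite (bigID (fun S : {set T} => h @: S == S)) /= [X in _ + X]big1 ?addr0; last first.
  by move=> S hS; rewrite AB_unstable // mulr0.
(* Sets of cycles and stable sets correspond by taking the union, and back by selecting the cycles
   contained in S. *)
rewrite (reindex_onto (fun A : {set {set T}} => cover A)
   (fun S : {set T} => [set X in porbits h | X \subset S])) /=; last first.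
  move=> S /eqP hS; apply/setP=> x; apply/bigcupP/idP => [[X]|xS].
    by rewrite inE => /andP[_ /subsetP]; apply.
  by exists (porbit h x); rewrite ?porbit_id // inE porbit_in porbit_sub ?hS.
have stab (A : {set {set T}}) : A \subset porbits h -> h @: cover A = cover A.
  move=> /subsetP As; apply/eqP; rewrite eqEcard card_imset ?leqnn ?andbT; last exact: perm_inj.
  apply/subsetP=> _ /imsetP[x /bigcupP[X XA xX] ->]; apply/bigcupP; exists X => //.
  by rewrite (mem_porbits (As _ XA) xX) porbit_stable // porbit_id.
have inv (A : {set {set T}}) : A \subset porbits h ->
    [set X in porbits h | X \subset cover A] = A.
  move=> As; apply/setP=> X; rewrite inE; apply/andP/idP => [[Xh /subsetP XA]|XA].
    have [x xX] := porbits_neq0 Xh.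
    have /bigcupP[Y YA xY] := XA x xX.
    by rewrite (mem_porbits Xh xX) -(mem_porbits (subsetP As _ YA) xY).
  by rewrite (subsetP As) //; split => //; apply: bigcup_max XA _.
apply: eq_big => [A|A /andP[/eqP hA /eqP eA]].
  apply/andP/idP => [[_ /eqP<-]|As]; last by rewrite inv // stab // !eqxx.
  by apply/subsetP=> X; rewrite inE => /andP[].
have As : A \subset porbits h by rewrite -eA; apply/subsetP=> X; rewrite inE => /andP[].
rewrite exprNn mulrAC -(rmorph_sign polyC) -rmorphM /= AB_stable // eA.
have /eqP <- := trivIset_porbits As.
by rewrite prodrN -prodrXr (rmorph_sign polyC).
Qed.

Lemma hookpoly_cycles h :
  (1 - 'X) * hookpoly K h = #|T|%:R * \prod_(X in porbits h) (1 - 'X^#|X|).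
Proof. by rewrite hookpoly_mul sum_AB_cycles. Qed.

Lemma poly_1BX_neq0 : (1 - 'X : {poly K}) != 0.
Proof. by rewrite -opprB oppr_eq0 polyXsubC_eq0. Qed.

Lemma geom_poly n : 1 - 'X^n = (1 - 'X) * \sum_(i < n) 'X^i :> {poly K}.
Proof.
rewrite -[1 in LHS](expr1n _ n) subrXX; congr (_ * _).
by apply: eq_bigr => i _; rewrite expr1n mul1r.
Qed.

(** The factor of one cycle C, divided by 1 - X, takes the value |C| at 1, and every further cycle
    contributes a zero factor. A single cycle has |C| = |T|, whence the square. *)
Lemma hookpoly1 h : (0 < #|T|)%N ->
  (hookpoly K h).[1] = (#|T|%:R ^+ 2) *+ (#|porbits h| == 1)%N.
Proof.
move=> T0; case: (posnP #|porbits h|) => [p0|].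
  have /card_gt0P[x _] := T0; have := porbit_in h x.
  by rewrite (cards0_eq p0) inE.
move=> /card_gt0P[X Xh].
have eh := hookpoly_cycles h.
rewrite (bigD1 X) //= geom_poly mulrCA -!mulrA in eh.
move/(mulfI poly_1BX_neq0): eh => ->.
rewrite !hornerM horner_sum -polyC_natr hornerC.
have -> : \sum_(i < #|X|) 'X^i.[1] = #|X|%:R :> K.
  by rewrite (eq_bigr (fun=> 1)) ?sumr_const ?card_ord // => i _; rewrite hornerXn expr1n.
rewrite horner_prod.
case: eqP => [p1|p1].
  have pX : porbits h = [set X].
    by apply/eqP; rewrite eq_sym eqEcard sub1set Xh cards1 p1.
  have := sum_card_porbits h; rewrite pX big_set1 => ->.
  rewrite big_pred0 ?mulr1 ?expr2 // => Y; rewrite inE.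
  by case: eqP.
have [Y Yh YX] : exists2 Y, Y \in porbits h & Y != X.
  have: (0 < #|porbits h :\ X|)%N.
    by have := cardsD1 X (porbits h); rewrite Xh; lia.
  by case/card_gt0P=> Y; rewrite !inE => /andP[]; exists Y.
by rewrite (bigD1 Y) ?Yh //= hornerD hornerN hornerXn hornerC expr1n subrr mul0r !mulr0 ?mulr0n.
Qed.

End CycleProduct.

(** The falling factorial of ['X + c]. In the variable u it is both the content polynomial of a hook
    and the n-th derivative of x^(c + u) at x = 1, which links the two sides of the theorem. *)
Definition ffpoly (K : numDomainType) (c : K) (n : nat) : {poly K} :=
  (\prod_(j < n) ('X + (c - j%:R)%:P))%R.

(** * Eigenvalues of class sums on hooks *)

Section Eigenvalue.

Import mathcomp.algebra_tactics.ring.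

Variables (T : finType) (K : numDomainType).
Implicit Types (U S R D : {set T}) (g h s r t : {perm T}).
Local Open Scope ring_scope.

(** The fixed point b is merged into the cycle of c. Moving the transposition to the left of g, as
    [porbits_mul_tperm] expects, replaces c by its preimage c'. *)
Lemma card_porbits_insert g b c : g b = b -> c != b ->
  #|porbits (g * tperm b c)%g|.+1 = #|porbits g|.
Proof.
move=> gb cb; pose c' := (g^-1)%g c.
have -> : (g * tperm b c = tperm b c' * g)%g.
  by rewrite -{1}gb -{1}[c](permKV g) -tpermJ conjgE mulKVg.
have := porbits_mul_tperm g b c'.
have -> : b \notin porbit g c'.
  rewrite porbit_sym porbit_fixed // inE /c'.
  by apply: contra cb => /eqP e; rewrite -[c](permKV g) e gb.
have -> : b != c'.
  by apply: contra cb => /eqP e; rewrite -[c](permKV g) -/c' -e gb.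
by lia.
Qed.

Lemma porbits_card1 g : #|porbits g| = #|T| -> g = 1%g.
Proof.
move=> gT; apply/permP=> x; rewrite perm1.
have inj : {in T &, injective (porbit g)}.
  by apply/imset_injP; rewrite -/(porbits g) gT.
by apply: inj => //; apply/eqP; rewrite eq_porbit_mem (mem_porbit g 1).
Qed.

Lemma porbits1 : #|porbits (1%g : {perm T})| = #|T|.
Proof.
rewrite card_imset // => x y; rewrite !porbit_fixed ?perm1 //; exact: set1_inj.
Qed.

(** Lets the transpositions be treated as a level set of the number of cycles. If g moves x,
    composing with [tperm x (g x)] splits a cycle, which raises the number of cycles to #|T| and so
    gives the identity. *)
Lemma card_porbits_tperm g : (#|porbits g|.+1 == #|T|)%N =
  [exists x, exists y, (x != y) && (g == tperm x y)].
Proof.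
apply/eqP/existsP => [gT|[x /existsP[y /andP[xy /eqP->]]]]; last first.
  by rewrite -[tperm x y]mul1g card_porbits_insert ?perm1 1?eq_sym // porbits1.
have [x gx] : exists x, g x != x.
  apply/existsP; apply: contraT; rewrite negb_exists => /forallP g1.
  have e : g = 1%g by apply/permP=> x; rewrite perm1; apply/eqP; rewrite -[_ == _]negbK.
  by move: gT; rewrite e porbits1 => /eqP; rewrite eqn_leq ltnn.
exists x; apply/existsP; exists (g x); rewrite eq_sym gx /=.
have := porbits_mul_tperm g x (g x).
rewrite porbit_sym (mem_porbit g 1) [x == _]eq_sym gx /= addn0 addn1 gT => /porbits_card1 e.
by rewrite -[g in g == _](mulKg (tperm x (g x))) e mulg1 tpermV.
Qed.

Lemma card_porbits_conj g s : #|porbits (g ^ s)%g| = #|porbits g|.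
Proof.
have e x : porbit (g ^ s)%g (s x) = s @: porbit g x.
  apply/setP=> y; apply/porbitP/imsetP => [[i ->]|[_ /porbitP[i ->] ->]].
    by exists ((g ^+ i)%g x); rewrite ?mem_porbit // -conjXg permJ.
  by exists i; rewrite -conjXg permJ.
rewrite -(card_imset (porbits g) (imset_inj (@perm_inj _ s))); congr #|pred_of_set _|.
apply/setP=> X; apply/imsetP/imsetP => [[x _ ->]|[_ /imsetP[x _ ->] ->]].
  by exists (porbit g (s^-1%g x)); rewrite ?porbit_in // -e permKV.
by exists (s x).
Qed.

(** The eigenvalue of the class function u^(number of cycles) on A_S B_R, as a polynomial in u =
    ['X]. *)
Definition sgnsum S R : {poly K} :=
  \sum_(s in Sym S) \sum_(r in Sym R) psign K s *: 'X^#|porbits (s * r)%g|.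

(** Cycles are counted on all of T, so b is already a fixed point on the right. Leaving it fixed
    keeps the exponent, inserting it before one of the #|R| points lowers it by one; the factor ['X]
    on the left compensates. *)
Lemma sgnsum_insertr S R b : b \notin S -> b \notin R ->
  'X * sgnsum S (b |: R) = ('X + #|R|%:R%:P) * sgnsum S R.
Proof.
move=> bS bR; rewrite /sgnsum !mulr_sumr; apply: eq_bigr => s.
rewrite inE => sS; rewrite sum_Sym_insert // !mulr_sumr; apply: eq_bigr => r.
rewrite inE => rR; rewrite big_setU1 //= tperm1 mulg1 mulrDr mulrDl; congr (_ + _).
have srb : (s * r)%g b = b by rewrite permM (out_perm sS) // (out_perm rR).
rewrite mulr_sumr (eq_bigr (fun _ => psign K s *: 'X^#|porbits (s * r)%g|)).
  by rewrite sumr_const polyC_natr mulr_natl.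
move=> c cR; have cb : c != b by apply: contraNneq bR => <-.
by rewrite mulgA -(card_porbits_insert srb cb) -scalerAr exprS.
Qed.

Lemma sgnsum_insertl S R b : b \notin S -> b \notin R ->
  'X * sgnsum (b |: S) R = ('X - #|S|%:R%:P) * sgnsum S R.
Proof.
move=> bS bR; rewrite /sgnsum sum_Sym_insert // !mulr_sumr; apply: eq_bigr => s.
rewrite inE => sS; rewrite exchange_big /= !mulr_sumr; apply: eq_bigr => r.
rewrite inE => rR; rewrite big_setU1 //= tperm1 mulg1 mulrDr mulrDl; congr (_ + _).
have srb : (s * r)%g b = b by rewrite permM (out_perm sS) // (out_perm rR).
rewrite mulr_sumr (eq_bigr (fun _ => - (psign K s *: 'X^#|porbits (s * r)%g|))).
  by rewrite sumr_const polyC_natr mulNr mulr_natl mulNrn.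
move=> c cS; have cb : c != b by apply: contraNneq bS => <-.
have rcb : r c != b by rewrite -(inj_eq (@perm_inj _ r)) in cb; rewrite (out_perm rR bR) in cb.
(* The transposition is carried past r, which fixes b and sends c to [r c]. *)
have -> : (s * tperm b c * r = s * r * tperm b (r c))%g.
  by rewrite -{2}(out_perm rR bR) -tpermJ conjgE !mulgA mulgK.
rewrite -(card_porbits_insert srb rcb) -scalerAr exprS psignM psign_tperm 1?eq_sym //.
by rewrite mulrN1 scaleNr.
Qed.

Lemma sgnsum_unionr S R D : [disjoint D & S] -> [disjoint D & R] ->
  'X^#|D| * sgnsum S (D :|: R) =
  \prod_(j < #|D|) ('X + (#|R| + j)%:R%:P) * sgnsum S R.
Proof.
move En: #|D| => n; elim: n => [|n IH] in D En *.
  by rewrite (cards0_eq En) set0U big_ord0 expr0.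
move=> DS DR; have /card_gt0P[b bD] : (0 < #|D|)%N by rewrite En.
have En' : #|D :\ b| = n by move: En; rewrite (cardsD1 b D) bD; lia.
rewrite -{1}(setD1K bD) -setUA exprSr -mulrA sgnsum_insertr; last first.
- by rewrite !inE eqxx /= (disjointFr DR bD).
- by rewrite (disjointFr DS bD).
have sub : D :\ b \subset D by rewrite subD1set.
rewrite mulrCA (IH _ En') ?(disjointWl sub) // mulrA big_ord_recr /=; congr (_ * _).
rewrite mulrC; congr (_ * ('X + _%:R%:P)).
rewrite cardsU En' (_ : _ :&: _ = set0) ?cards0; first by lia.
by apply/eqP; rewrite setI_eq0 (disjointWl sub).
Qed.

Lemma sgnsum_unionl S R D : [disjoint D & S] -> [disjoint D & R] ->
  'X^#|D| * sgnsum (D :|: S) R =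
  \prod_(j < #|D|) ('X - (#|S| + j)%:R%:P) * sgnsum S R.
Proof.
move En: #|D| => n; elim: n => [|n IH] in D En *.
  by rewrite (cards0_eq En) set0U big_ord0 expr0.
move=> DS DR; have /card_gt0P[b bD] : (0 < #|D|)%N by rewrite En.
have En' : #|D :\ b| = n by move: En; rewrite (cardsD1 b D) bD; lia.
rewrite -{1}(setD1K bD) -setUA exprSr -mulrA sgnsum_insertl; last first.
- by rewrite (disjointFr DR bD).
- by rewrite !inE eqxx /= (disjointFr DS bD).
have sub : D :\ b \subset D by rewrite subD1set.
rewrite mulrCA (IH _ En') ?(disjointWl sub) // mulrA big_ord_recr /=; congr (_ * _).
rewrite mulrC; congr (_ * ('X - _%:R%:P)).
rewrite cardsU En' (_ : _ :&: _ = set0) ?cards0; first by lia.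
by apply/eqP; rewrite setI_eq0 (disjointWl sub).
Qed.

Lemma sgnsum11 a : sgnsum [set a] [set a] = 'X^#|T|.
Proof.
have e : Sym [set a] = [set 1%g] :> {set {perm T}}.
  apply/eqP; rewrite eq_sym eqEcard sub1set group1 card_Sym !cards1 //.
by rewrite /sgnsum e !big_set1 mulg1 porbits1 /psign odd_perm1 scale1r.
Qed.

(** The contents of a hook with arm p and leg q: p, ..., 1, then 0, then -1, ..., -q. *)
Lemma ffpoly_hook p q :
  ffpoly (p%:R : K) (p + q.+1) =
  (\prod_(j < p) ('X + (1 + j)%:R%:P)) * 'X * (\prod_(j < q) ('X - (1 + j)%:R%:P)).
Proof.
rewrite /ffpoly big_split_ord big_ord_recl /= -mulrA; congr (_ * _).
  rewrite (reindex_inj rev_ord_inj) /=; apply: eq_bigr => j _.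
  by rewrite -natrB ?leq_subr // subKn // add1n.
rewrite addn0 subrr addr0; congr (_ * _); apply: eq_bigr => j _.
rewrite -[- _%:P]rmorphN /=; congr ('X + _%:P).
by rewrite /bump /= natrD opprD addrA subrr add0r.
Qed.

(** The hook grows from the single point a: the leg U enlarges S and the arm D enlarges R, each new
    point bringing its content. *)
Lemma sgnsum_hook U a : a \notin U ->
  sgnsum (a |: U) (~: U) = ffpoly (#|T| - 1 - #|U|)%:R #|T|.
Proof.
move=> aU; pose D := ~: (a |: U).
have cU : #|a |: U| = #|U|.+1 by rewrite cardsU1 aU.
have cD : #|D| = (#|T| - 1 - #|U|)%N by rewrite cardsCs setCK cU; lia.
have le : (#|U|.+1 <= #|T|)%N by rewrite -cU max_card.
have DUa : ~: U = D :|: [set a].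
  apply/setP=> x; rewrite !inE; case: (eqVneq x a) => [->|] //=.
  by rewrite orbF.
have DS : [disjoint D & a |: U] by rewrite -setI_eq0 setIC setICr.
have Da : [disjoint D & [set a]] by apply: disjointWr DS; rewrite sub1set setU11.
have Ua : [disjoint U & [set a]] by rewrite disjoint_sym disjoints1.
have Xn n : 'X^n != 0 :> {poly K} by rewrite expf_neq0 // polyX_eq0.
(* Every insertion formula carries a factor ['X] on its left side, one for each point of U and D. *)
apply: (mulfI (Xn (#|U| + #|D|)%N)).
rewrite {1}DUa exprD -mulrA sgnsum_unionr // mulrCA setUC sgnsum_unionl // sgnsum11.
rewrite cards1 -cD [in ffpoly _ _](_ : #|T| = #|D| + #|U|.+1)%N; last by rewrite cD; lia.
rewrite ffpoly_hook (_ : #|T| = #|U| + #|D| + 1)%N; last by rewrite cD; lia.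
by rewrite exprD expr1 -exprD; ring.
Qed.

Lemma hook_eigen m U a h : a \notin U ->
  \sum_(g : {perm T} | #|porbits g| == m) AB (a |: U) (~: U) (g^-1 * h)%g =
  (ffpoly (#|T| - 1 - #|U|)%:R #|T|)`_m * AB (a |: U) (~: U) h :> K.
Proof.
move=> aU; rewrite big_mkcond /=.
pose psi g : K := (#|porbits g| == m)%:R.
have psiJ g s : psi (g ^ s)%g = psi g.
  by rewrite /psi card_porbits_conj.
have UT : (a |: U) :|: ~: U = setT by rewrite -setUA setUCr setUT.
have Ua : (a |: U) :&: ~: U = [set a].
  by apply/setP=> x; rewrite !inE; case: (eqVneq x a) => [->|] //=; rewrite andbN.
rewrite (eq_bigr (fun g => psi g * AB (a |: U) (~: U) (g^-1 * h)%g)); last first.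
  by move=> g _; rewrite /psi; case: eqP => _; rewrite ?mul1r ?mul0r.
rewrite (AB_eigen h UT Ua psiJ); congr (_ * _).
rewrite -(sgnsum_hook aU) /sgnsum coef_sum; apply: eq_bigr => s _.
rewrite coef_sum; apply: eq_bigr => r _.
by rewrite coefZ coefXn /psi porbitsV eq_sym.
Qed.

(** The subleading coefficient is the sum of the c - j, doubled since [K] need not contain 1/2. For
    c = n - 1 - k the right side is n (n - 1 - 2k). *)
Lemma ffpoly_subtop (c : K) n : (0 < n)%N ->
  2%:R * (ffpoly c n)`_n.-1 = n%:R * (c *+ 2 - n.-1%:R).
Proof.
move=> n0; rewrite /ffpoly.
have eI : iota 0 n = index_iota 0 n by rewrite /index_iota subn0.
have -> : \prod_(j < n) ('X + (c - j%:R)%:P) =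
          \prod_(p <- [seq j%:R - c | j <- iota 0 n]) ('X - p%:P).
  rewrite big_map eI big_mkord.
  by apply: eq_bigr => j _; rewrite -rmorphN opprB.
have := @coefPn_prod_XsubC K [seq j%:R - c | j <- iota 0 n].
rewrite size_map size_iota => -> //; last by rewrite -lt0n.
rewrite big_map eI big_mkord.
rewrite sumrB opprB sumr_const card_ord mulrBr.
case: n n0 {eI} => // n _ /=.
have -> : 2%:R * (\sum_(i < n.+1) i%:R) = (n.+1 * n)%:R :> K.
  rewrite -natr_sum -natrM; congr (_%:R).
  by rewrite -(big_mkord xpredT id) bin2_sum -mul_bin_diag bin1.
by rewrite natrM -[c *+ n.+1]mulr_natr -[c *+ 2]mulr_natr; ring.
Qed.

End Eigenvalue.

(** * Sizes of conjugacy classes *)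

Section ClassSize.

Import mathcomp.algebra_tactics.ring.
Local Open Scope nat_scope.

Variable T : finType.
Implicit Types (A U S R D : {set T}) (g h s r t : {perm T}).

(** Restricted to cycles inside A, because a permutation of A fixes the points outside A and these
    must not enter its cycle type. *)
Definition ncyc A g i := \sum_(X in porbits g | X \subset A) (#|X| == i).

(** Right multiplication by [tperm b c] inserts b just before c. One inclusion holds since the
    enlarged cycle is stable under the product, the other since the new cycle without b is stable
    under g. *)
Lemma porbit_insert g b c : g b = b -> c != b ->
  porbit (g * tperm b c) c = b |: porbit g c.
Proof.
move=> gb cb; set g' := (g * tperm b c)%g.
have bO : b \notin porbit g c by rewrite porbit_sym porbit_fixed // inE.
have g'b : g' b = c by rewrite permM gb tpermL.
have gxb x : x != b -> g x != b by apply: contra => /eqP e; apply/eqP/(@perm_inj _ g); rewrite gb.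
have g'E x : x != b -> g x != c -> g' x = g x.
  by move=> xb gxc; rewrite permM tpermD 1?eq_sym // gxb.
apply/eqP; rewrite eqEsubset; apply/andP; split.
  apply: porbit_sub; last by rewrite inE porbit_id orbT.
  apply/subsetP=> _ /imsetP[x + ->]; rewrite !inE => /predU1P[->|xO].
    by rewrite g'b porbit_id orbT.
  have xb : x != b by apply: contraNneq bO => <-.
  case: (eqVneq (g x) c) => gxc; first by rewrite permM gxc tpermR eqxx.
  by rewrite g'E // porbit_stable ?orbT.
have bY : b \in porbit g' c by rewrite porbit_sym -g'b (mem_porbit g' 1).
rewrite subUset sub1set bY /=.
apply: subset_trans (_ : porbit g' c :\ b \subset _); last by rewrite subD1set.
apply: porbit_sub; last by rewrite !inE cb porbit_id.
apply/subsetP=> _ /imsetP[x + ->]; rewrite !inE => /andP[xb xY].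
rewrite gxb //=; case: (eqVneq (g x) c) => [->|gxc]; first exact: porbit_id.
by rewrite -g'E // porbit_stable.
Qed.

Lemma porbits_insert g b c : g b = b -> c != b ->
  porbits (g * tperm b c) = (b |: porbit g c) |: (porbits g :\ [set b] :\ porbit g c).
Proof.
move=> gb cb; set g' := (g * tperm b c)%g.
have bO : b \notin porbit g c by rewrite porbit_sym porbit_fixed // inE.
have gO := porbit_insert gb cb; rewrite -/g' in gO.
have gy y : y != b -> y \notin porbit g c -> porbit g' y = porbit g y.
  move=> yb yO; apply: porbit_eq => z zy.
  rewrite permM tpermD //.
    apply: contraNneq yb => e; have: g z \in porbit g y by apply: porbit_stable.
    by rewrite -e porbit_sym porbit_fixed // inE.
  apply: contraNneq yO => e; have: g z \in porbit g y by apply: porbit_stable.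
  by rewrite -e porbit_sym.
apply/setP=> X; rewrite !inE; apply/imsetP/idP => [[y _ ->]|].
  case: (boolP (y \in b |: porbit g c)) => yO.
    by rewrite -gO in yO *; move: yO; rewrite -eq_porbit_mem => ->.
  move: (yO); rewrite !inE negb_or => /andP[yb yc].
  have yb' : porbit g y != [set b].
    by rewrite -(porbit_fixed gb) eq_porbit_mem porbit_fixed // inE.
  by rewrite gy // porbit_in eq_porbit_mem yc yb' orbT.
case/predU1P=> [->|/and3P[XO Xb /imsetP[y _ eX]]]; first by exists c.
exists y => //; rewrite eX in XO Xb *; rewrite gy //.
  by apply: contra Xb => /eqP->; rewrite porbit_fixed.
by rewrite -eq_porbit_mem.
Qed.

(* Length of the cycle of [g] into which [b] is inserted, 0 if [b] stays fixed. *)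
Definition inslen g b c := if c == b then 0 else #|porbit g c|.

(** A cycle gives way to one longer by 1. Placing the indicators on opposite sides avoids truncated
    subtraction, and 0 < j discards the fictitious length 0. *)
Lemma ncyc_insert A g b c j : g \in Sym A -> b \notin A -> c \in b |: A -> 0 < j ->
  ncyc (b |: A) (g * tperm b c) j + (j == inslen g b c) =
  ncyc A g j + (j == (inslen g b c).+1).
Proof.
move=> gA bA cA j0; have gA' : perm_on A g by rewrite inE in gA.
have gb : g b = b by rewrite (out_perm gA').
have subA X : X \in porbits g -> X != [set b] -> (X \subset b |: A) = (X \subset A).
  move=> Xg Xb; apply/idP/idP => [/subsetP XA|]; last first.
    by move=> XA; apply: subset_trans XA _; rewrite subsetUr.
  apply/subsetP=> x xX; have := XA x xX; rewrite !inE => /predU1P[e|//].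
  case/eqP: Xb; by rewrite (mem_porbits Xg xX) e porbit_fixed.
rewrite /inslen; case: (eqVneq c b) => [->|cb].
  rewrite tperm1 mulg1 (gtn_eqF j0) addn0 /ncyc.
  rewrite (bigD1 [set b]) /=; last by rewrite -(porbit_fixed gb) porbit_in porbit_fixed // sub1set setU11.
  rewrite cards1 eq_sym addnC; congr (_ + _); apply: eq_bigl => X.
  case: (boolP (X \in porbits g)) => //= Xg.
  case: (eqVneq X [set b]) => [->|Xb]; last by rewrite andbT subA.
  by rewrite andbF sub1set (negbTE bA).
have cA' : c \in A by move: cA; rewrite !inE (negbTE cb).
have bO : b \notin porbit g c by rewrite porbit_sym porbit_fixed // inE.
have OA : porbit g c \subset A.
  apply: porbit_sub => //; apply/subsetP=> _ /imsetP[x xA ->].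
  by rewrite (perm_closed _ gA').
rewrite /ncyc porbits_insert // [in LHS]big_mkcondr big_setU1 /=; last first.
  rewrite !inE; apply/negP=> /and3P[_ Xb Xg].
  have e := mem_porbits Xg (setU11 _ _); rewrite (porbit_fixed gb) in e.
  by rewrite e eqxx in Xb.
have -> : b |: porbit g c \subset b |: A by rewrite setUS.
rewrite cardsU1 bO add1n.
rewrite [in RHS](bigD1 (porbit g c)) /= ?porbit_in ?OA //.
rewrite [X in _ + X + _ = _](_ : _ =
  \sum_(X in porbits g | (X \subset A) && (X != porbit g c)) (#|X| == j)).
  under [in RHS]eq_bigl do rewrite -andbA.
  by rewrite [_.+1 == j]eq_sym [#|porbit g c| == j]eq_sym addnC [X in _ + X]addnC addnA.
rewrite [LHS]big_mkcond [RHS]big_mkcond /=; apply: eq_bigr => X _.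
rewrite !inE; case: (boolP (X \in porbits g)) => Xg; last by rewrite !andbF.
rewrite /= andbT; case: (eqVneq X (porbit g c)) => XO //=; rewrite ?andbF ?andbT //.
case: (eqVneq X [set b]) => [->|Xb] /=; last by rewrite subA.
by rewrite sub1set (negbTE bA).
Qed.

Lemma card_porbit_ncyc A g i : g \in Sym A ->
  \sum_(c in A) (#|porbit g c| == i) = i * ncyc A g i.
Proof.
rewrite inE => gA; pose P := [set X in porbits g | X \subset A].
have AP : A = cover P.
  apply/setP=> x; apply/idP/bigcupP => [xA|[X]].
    exists (porbit g x); rewrite ?porbit_id // inE porbit_in porbit_sub //.
    by apply/subsetP=> _ /imsetP[y yA ->]; rewrite (perm_closed _ gA).
  by rewrite inE => /andP[_ /subsetP]; apply.
have Pg : P \subset porbits g by apply/subsetP=> X; rewrite inE => /andP[].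
rewrite {1}AP big_trivIset ?(trivIset_porbits Pg) //= /ncyc big_distrr /=.
apply: eq_big => [X|X XP]; first by rewrite inE.
rewrite (eq_bigr (fun _ => (#|X| == i : nat))); last first.
  by move=> c cX; rewrite -(mem_porbits (subsetP Pg _ XP) cX).
by rewrite sum_nat_const; case: eqP => [->|]; rewrite ?muln1 ?muln0.
Qed.

Definition has_type (n : nat) A g (a : nat -> nat) :=
  [forall j : 'I_n.+1, (0 < j) ==> (ncyc A g j == a j)].

(* Index 0 carries no cycles: [has_type] ignores it and its weight is 1, which
   lets a fixed point be created from a cycle "of length 0". *)
Definition zweight j x := if j == 0 then 1 else j ^ x * x`!.
Definition zratio j x := if j == 0 then 1 else j * x.

Lemma zweightS j x : zweight j x.+1 = zratio j x.+1 * zweight j x.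
Proof. by rewrite /zweight /zratio; case: eqP => // _; rewrite expnS factS; ring. Qed.

Lemma ncyc_eq0 A g j : #|A| < j -> ncyc A g j = 0.
Proof.
move=> Aj; rewrite /ncyc big1 // => X /andP[_ /subset_leq_card XA].
by case: eqP => // e; rewrite e in XA; lia.
Qed.

(* One cycle of length [i.+1] of the type [a] is shortened to length [i]. *)
Definition dec_type (a : nat -> nat) i j := a j + (j == i) - (j == i.+1).

Lemma zweight_dec n (a : nat -> nat) i : i < n -> 0 < a i.+1 ->
  (\prod_(j < n.+1) zweight j (a j)) * zratio i (a i).+1 =
  (\prod_(j < n.+1) zweight j (dec_type a i j)) * zratio i.+1 (a i.+1).
Proof.
move=> lin ai.
have i1 : i < n.+1 by lia.
rewrite (bigD1 (Ordinal i1)) //= (bigD1 (Ordinal (lin : i.+1 < n.+1))) /=; last first.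
  by rewrite -val_eqE /=; lia.
rewrite [in RHS](bigD1 (Ordinal i1)) //= [in RHS](bigD1 (Ordinal (lin : i.+1 < n.+1))) /=; last first.
  by rewrite -val_eqE /=; lia.
rewrite [X in _ * (_ * X) * _ = _](_ : _ = \prod_(j < n.+1 | (j != Ordinal i1) && (j != Ordinal (lin : i.+1 < n.+1)))
   zweight j (dec_type a i j)); last first.
  apply: eq_bigr => j; rewrite -!val_eqE /= => /andP[/negbTE ji /negbTE ji1].
  by rewrite /dec_type ji ji1 addn0 subn0.
have -> : dec_type a i i = (a i).+1.
  by rewrite /dec_type eqxx (_ : i == i.+1 = false) ?addn1 ?subn0 //; lia.
have -> : dec_type a i i.+1 = (a i.+1).-1.
  by rewrite /dec_type eqxx (_ : i.+1 == i = false) ?addn0 ?subn1 //; lia.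
rewrite -{1}(prednK ai) !zweightS (prednK ai); ring.
Qed.

(** The product of the weights is the order of the centralizer. Induction on #|A|: a permutation of
    type a arises by inserting a point b into a cycle of length i of a permutation of type
    [dec_type a i], in i (a_i + 1) ways, or in one way if i = 0. *)
Lemma card_has_type n A (a : nat -> nat) : #|A| <= n ->
  \sum_(j < n.+1) j * a j = #|A| ->
  (\sum_(g in Sym A) has_type n A g a) * (\prod_(j < n.+1) zweight j (a j)) = #|A|`!.
Proof.
move Ek: #|A| => k; elim: k => [|k IH] in A Ek a *.
  move=> _ /eqP; rewrite sum_nat_eq0 => /forallP /= a0.
  have a0' (j : 'I_n.+1) : 0 < j -> a j = 0.
    by move=> j0; have := a0 j; rewrite muln_eq0 => /orP[]/eqP //; lia.
  have A0 := cards0_eq Ek.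
  have -> : Sym A = [set 1%g].
    by apply/eqP; rewrite eq_sym eqEcard sub1set group1 card_Sym Ek cards1.
  rewrite big_set1 (_ : has_type _ _ _ _) /=; last first.
    apply/forallP=> j; apply/implyP=> j0; rewrite a0' // ncyc_eq0 // Ek; lia.
  rewrite big1 // => j _; rewrite /zweight; case: eqP => // /eqP j0.
  by rewrite a0' ?lt0n // expn0.
move=> kn suma; have /card_gt0P[b bA] : 0 < #|A| by rewrite Ek.
have Ek' : #|A :\ b| = k by move: Ek; rewrite (cardsD1 b A) bA; lia.
have bB : b \notin A :\ b by rewrite !inE eqxx.
pose B := A :\ b.
have lt g c : g \in Sym B -> c \in b |: B -> inslen g b c < n.
  move=> gB cB; rewrite /inslen; case: eqP => cb; first by lia.
  have cB' : c \in B by move: cB; rewrite !inE (introF eqP cb).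
  suff: #|porbit g c| <= #|B| by rewrite Ek'; lia.
  apply/subset_leq_card/porbit_sub => //; apply/subsetP=> _ /imsetP[x xB ->].
  by move: gB; rewrite inE => gB; rewrite (perm_closed _ gB).
have step g : g \in Sym B ->
    \sum_(c in b |: B) has_type n (b |: B) (g * tperm b c) a =
    \sum_(i < n | 0 < a i.+1) zratio i (a i).+1 * has_type n B g (dec_type a i).
  move=> gB.
  have ht c : c \in b |: B -> has_type n (b |: B) (g * tperm b c) a =
      (0 < a (inslen g b c).+1) && has_type n B g (dec_type a (inslen g b c)).
    move=> cB; have := lt g c gB cB; set i := inslen g b c => ltin.
    apply/forallP/andP => [h|[ai /forallP h] j].
      have hE j : 0 < j -> j <= n -> ncyc (b |: B) (g * tperm b c) j = a j.
        by move=> j0 jn; have := h (Ordinal (jn : j < n.+1)); rewrite /= j0 => /eqP.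
      have hI j j0 := @ncyc_insert B g b c j gB bB cB j0.
      split.
        have := hI i.+1 isT; rewrite hE // -/i eqxx.
        by rewrite (_ : i.+1 == i = false); lia.
      apply/forallP=> j; apply/implyP=> j0; have := hI j j0.
      rewrite (hE _ j0 (ltn_ord j)) -/i => e; apply/eqP; rewrite /dec_type; lia.
    apply/implyP=> j0; have := h j; rewrite j0 => /eqP e.
    have := @ncyc_insert B g b c j gB bB cB j0; rewrite e /dec_type -/i => e'.
    apply/eqP; case: (eqVneq (j : nat) i.+1) e' => [ji|_]; last by lia.
    by rewrite ji in ai *; lia.
  rewrite (eq_bigr (fun c => \sum_(i < n | 0 < a i.+1)
      (inslen g b c == i) * has_type n B g (dec_type a i))); last first.
    move=> c cB; rewrite ht //; case: (boolP (0 < a _)) => /= ai.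
      rewrite (bigD1 (Ordinal (lt g c gB cB))) //= eqxx mul1n big1 ?addn0 //.
      move=> i /andP[_]; rewrite -val_eqE /= eq_sym => /negbTE ->.
      by rewrite mul0n.
    rewrite big1 // => i ai'; case: eqP => [e|]; last by rewrite mul0n.
    by rewrite e ai' in ai.
  rewrite exchange_big /=; apply: eq_bigr => i ai.
  rewrite -big_distrl /=; case: (boolP (has_type _ _ _ _)) => [/forallP h|]; last by rewrite !muln0.
  rewrite !muln1 big_setU1 //= {1}/inslen eqxx.
  rewrite (eq_bigr (fun c => (#|porbit g c| == i) : nat)); last first.
    by move=> c cB; rewrite /inslen (_ : c == b = false) //; apply: contraNF bB => /eqP e; rewrite -{1}e.
  rewrite card_porbit_ncyc // /zratio eq_sym.
  case: eqP => [->|/eqP i0]; first by rewrite mul0n.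
  have lin : i < n.+1 by apply: ltnW; apply: ltn_ord.
  have := h (Ordinal lin); rewrite /= lt0n i0 => /eqP->.
  rewrite /dec_type eqxx (_ : nat_of_ord i == i.+1 = false) ?addn1 ?subn0 //; lia.
have -> : A = b |: B by rewrite /B setD1K.
rewrite big_Sym_insert // (eq_bigr _ step) exchange_big /= big_distrl /=.
have dsum (i : 'I_n) : 0 < a i.+1 -> \sum_(j < n.+1) j * dec_type a i j = k.
  move=> ai.
  have i1 : i < n.+1 by apply: ltnW; apply: ltn_ord.
  have i2 : i.+1 < n.+1 by rewrite ltnS.
  have eq1 (l : 'I_n.+1) : \sum_(j < n.+1) j * (j == l :> nat) = l.
    rewrite (bigD1 l) //= eqxx muln1 big1 ?addn0 // => j.
    by rewrite -val_eqE /= => /negbTE->; rewrite muln0.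
  have: \sum_(j < n.+1) (j * dec_type a i j + j * (j == i.+1 :> nat)) =
        \sum_(j < n.+1) (j * a j + j * (j == i :> nat)).
    apply: eq_bigr => j _; rewrite -!mulnDr /dec_type; congr (_ * _).
    by case: (eqVneq (j : nat) i.+1) => [->|_]; lia.
  by rewrite !big_split /= (eq1 (Ordinal i1)) (eq1 (Ordinal i2)) suma /=; lia.
(* By induction and [zweight_dec] each i contributes k! (i + 1) a_(i+1), and the sum of the (i + 1)
   a_(i+1) is k + 1. *)
rewrite (eq_bigr (fun i : 'I_n => k`! * (i.+1 * a i.+1))); last first.
  move=> i ai; rewrite -big_distrr /= mulnAC [zratio _ _ * _]mulnC zweight_dec //.
  have := IH B Ek' (dec_type a i); rewrite dsum // => <- //; last by lia.
  by rewrite /zratio /=; ring.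
rewrite -big_distrr /= factS mulnC; congr (_ * _).
rewrite -suma big_ord_recl mul0n add0n big_mkcond /=; apply: eq_bigr => i _.
by case: ifP => //; rewrite lt0n => /negbFE/eqP->; rewrite muln0.
Qed.

End ClassSize.

(** * Cycle types and conjugacy classes *)

Section CycleType.

Local Open Scope nat_scope.

Lemma big_mult (S : comPzSemiRingType) (beta : seq nat) n (F : nat -> S) :
  all (fun b => b < n) beta ->
  (\prod_(b <- beta) F b = \prod_(i < n) F i ^+ Defs.mult beta i)%R.
Proof.
elim: beta => [|b beta IH] /= => [_|/andP[bn /IH e]].
  by rewrite big_nil big1 // => i _; rewrite expr0.
rewrite big_cons e /Defs.mult /=.
under [in RHS]eq_bigr do rewrite exprD.
rewrite big_split /=; congr (_ * _)%R.
rewrite (bigD1 (Ordinal bn)) //= eqxx expr1 big1 ?mulr1 //.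
by move=> i; rewrite -val_eqE eq_sym /= => /negbTE->.
Qed.

Lemma sumn_mult (beta : seq nat) n : all (fun b => b < n) beta ->
  \sum_(i < n) i * Defs.mult beta i = sumn beta.
Proof.
elim: beta => [|b beta IH] /= => [_|/andP[bn /IH <-]].
  by rewrite big1 // => i _; rewrite muln0.
under eq_bigr do rewrite /Defs.mult /= mulnDr.
rewrite big_split /= (bigD1 (Ordinal bn)) //= eqxx muln1 big1 ?addn0 //.
by move=> i; rewrite -val_eqE eq_sym /= => /negbTE->; rewrite muln0.
Qed.

Lemma leq_sumn (beta : seq nat) : all (fun b => b < (sumn beta).+1) beta.
Proof.
elim: beta => //= b beta IH; rewrite ltnS leq_addr /=.
by apply: sub_all IH => x; rewrite !ltnS => /leq_trans; apply; rewrite leq_addl.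
Qed.

Lemma mult0 beta : all (fun b => 0 < b) beta -> Defs.mult beta 0 = 0.
Proof. by move=> pos; apply/count_memPn/negP=> /(allP pos). Qed.

Variable d : nat.
Implicit Types (s : {perm 'I_d}) (beta : seq nat).

Lemma cards_porbits_ncyc s i :
  #|[set X in porbits s | #|X| == i]| = ncyc setT s i.
Proof.
rewrite /ncyc -sum1_card big_mkcond [RHS]big_mkcond /=; apply: eq_bigr => X _.
by rewrite !inE subsetT andbT; case: (X \in _) => //=; case: eqP.
Qed.

Lemma has_cycle_typeE s beta : all (fun b => 0 < b) beta ->
  has_cycle_type s beta = has_type d setT s (Defs.mult beta).
Proof.
move=> pos; apply/forallP/forallP => h i.
  by apply/implyP=> _; rewrite -cards_porbits_ncyc.
case: (posnP i) => [i0|i0]; last by have := h i; rewrite i0 cards_porbits_ncyc.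
rewrite i0 mult0 // cards_eq0; apply/eqP/setP=> X; rewrite !inE.
apply/negP=> /andP[/porbits_neq0[x xX]]; rewrite cards_eq0 => /eqP X0.
by rewrite X0 inE in xX.
Qed.

Lemma prod_porbits (S : comPzSemiRingType) s beta (F : nat -> S) :
  has_cycle_type s beta -> all (fun b => b < d.+1) beta ->
  (\prod_(X in porbits s) F #|X| = \prod_(b <- beta) F b)%R.
Proof.
move=> /forallP h le; rewrite (big_mult _ le).
have leX (X : {set 'I_d}) : #|X| < d.+1 by rewrite ltnS -[X in _ <= X]card_ord max_card.
rewrite (partition_big (fun X : {set 'I_d} => Ordinal (leX X)) xpredT) //=.
apply: eq_bigr => i _; rewrite -(eqP (h i)) -prodr_const.
apply: eq_big => [X|X /andP[_ /eqP <-]] //=.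
by rewrite !inE -val_eqE.
Qed.

Lemma is_full_cycleE s : 0 < d -> is_full_cycle s = (#|porbits s| == 1).
Proof.
move=> d0; apply/idP/eqP => [h|p1].
  (* Giving every cycle the weight X turns the number of cycles into a degree. *)
  have := @prod_porbits {poly int} s [:: d] (fun=> 'X%R) h.
  rewrite /= ltnSn big_seq1 prodr_const => /(_ isT) /(congr1 (fun p : {poly int} => size p)).
  by rewrite size_polyXn size_polyX => -[].
have /cards1P[X pX] : #|porbits s| == 1 by apply/eqP.
have := sum_card_porbits s; rewrite pX big_set1 card_ord => Xd.
apply/forallP=> i; rewrite cards_porbits_ncyc /ncyc pX big_mkcondr big_set1 subsetT Xd.
by rewrite /Defs.mult /= addn0.
Qed.

Lemma is_transpositionE s : 0 < d -> is_transposition s = (#|porbits s| == d.-1).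
Proof.
move=> d0; rewrite -eqSS prednK //.
by have := card_porbits_tperm s; rewrite card_ord => ->.
Qed.

Lemma card_class beta : all (fun b => 0 < b) beta -> sumn beta = d ->
  #|[set s : {perm 'I_d} | has_cycle_type s beta]| * \prod_(b <- beta) b * Aut beta = d`!.
Proof.
move=> pos sb.
have le : all (fun b => b < d.+1) beta by rewrite -sb leq_sumn.
have := @card_has_type 'I_d d setT (Defs.mult beta).
rewrite cardsT card_ord sumn_mult // sb => <- //.
rewrite -mulnA; congr (_ * _).
  rewrite -sum1_card big_mkcond [RHS]big_mkcond /=; apply: eq_bigr => s _.
  rewrite !inE has_cycle_typeE // (_ : perm_on _ _); last by apply/subsetP=> x; rewrite inE.
  by case: has_type.
rewrite /Aut sb (@big_mult nat beta d.+1 id le) big_ord_recl mult0 // expr0 mul1r.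
rewrite [RHS]big_ord_recl /= mul1n big_add1 /= big_mkord -big_split /=.
by apply: eq_bigr => i _.
Qed.

End CycleType.

(** * Counting factorizations *)

Section Count.

Variables (K : numDomainType) (d : nat).
Hypothesis d_gt0 : (0 < d)%N.
Notation G := {perm 'I_d}.
Implicit Types (U : {set 'I_d}) (g h s : G).
Local Open Scope ring_scope.

(** The eigenvalue, on hooks of leg length k, of the sum of all permutations with m cycles; m = d -
    1 gives the transpositions. *)
Definition eigval (k m : nat) : K := (ffpoly (d - 1 - k)%:R d)`_m.

Lemma hook_eigenl m U a h : a \notin U ->
  \sum_(g : G | #|porbits g| == m) AB (a |: U) (~: U) (g * h)%g =
  eigval #|U| m * AB (a |: U) (~: U) h :> K.
Proof.
move=> aU; have := @hook_eigen _ K m U a h aU; rewrite card_ord => <-.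
rewrite (reindex_inj invg_inj) /=; apply: eq_bigl => g.
by rewrite porbitsV.
Qed.

Lemma hook_eigenr m U a h : a \notin U ->
  \sum_(g : G | #|porbits g| == m) AB (a |: U) (~: U) (h * g)%g =
  eigval #|U| m * AB (a |: U) (~: U) h :> K.
Proof.
move=> aU; rewrite -hook_eigenl // (reindex_inj (conjg_inj h)) /=.
apply: eq_big => [g|g _]; first by rewrite card_porbits_conj.
by rewrite conjgE mulKVg.
Qed.

Lemma sum_ffun_recl (V : zmodType) (T : finType) t (P : pred T) (F : {ffun 'I_t.+1 -> T} -> V) :
  \sum_(f : {ffun 'I_t.+1 -> T} | [forall j, P (f j)]) F f =
  \sum_(f : {ffun 'I_t -> T} | [forall j, P (f j)]) \sum_(x | P x)
     F [ffun i => oapp f x (unlift ord0 i)].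
Proof.
rewrite pair_big_dep /=.
rewrite (reindex_onto (fun p : {ffun 'I_t -> T} * T => [ffun i => oapp p.1 p.2 (unlift ord0 i)])
  (fun f : {ffun 'I_t.+1 -> T} => ([ffun j => f (lift ord0 j)], f ord0))) /=; last first.
  move=> f _; apply/ffunP=> i; rewrite ffunE.
  by case: unliftP => [j ->|->] /=; rewrite ?ffunE.
apply: eq_bigl => [[f x]] /=.
have -> : ([ffun j => [ffun i => oapp f x (unlift ord0 i)] (lift ord0 j)],
   [ffun i => oapp f x (unlift ord0 i)] ord0) = (f, x).
  rewrite ffunE unlift_none; congr (_, _); apply/ffunP=> j.
  by rewrite !ffunE liftK.
rewrite eqxx andbT; apply/forallP/andP => [h|[/forallP h Px] i].
  split; last by have := h ord0; rewrite ffunE unlift_none.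
  by apply/forallP=> j; have := h (lift ord0 j); rewrite ffunE liftK.
by rewrite ffunE; case: unliftP => [j _|_] /=.
Qed.

Lemma sum_AB_transpositions t U a h : a \notin U ->
  \sum_(f : {ffun 'I_t -> G} | [forall j, is_transposition (f j)])
    AB (a |: U) (~: U) (h * (\prod_(j < t) f j)^-1)%g =
  eigval #|U| d.-1 ^+ t * AB (a |: U) (~: U) h :> K.
Proof.
move=> aU; elim: t h => [|t IH] h.
  rewrite (bigD1 [ffun=> 1%g]) /=; last by apply/forallP=> -[].
  rewrite big_ord0 invg1 mulg1 expr0 mul1r big1 ?addr0 // => f /andP[_].
  by case/eqP; apply/ffunP=> -[].
rewrite (@sum_ffun_recl K G t (@is_transposition d)).
transitivity (\sum_(f : {ffun 'I_t -> G} | [forall j, is_transposition (f j)])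
    eigval #|U| d.-1 * AB (a |: U) (~: U) (h * (\prod_(j < t) f j)^-1)%g).
  apply: eq_bigr => f _; rewrite -hook_eigenr // (reindex_inj invg_inj) /=.
  apply: eq_big => [x|x _]; first by rewrite is_transpositionE // porbitsV.
  rewrite big_ord_recl ffunE unlift_none /= invMg invgK mulgA.
  congr (AB _ _ (h * _^-1 * _)%g); apply: eq_bigr => j _.
  by rewrite ffunE liftK.
by rewrite -mulr_sumr IH exprS mulrA.
Qed.

(** The sets U of size k make up the coefficient of degree k, so weights depending on #|U| pass to
    coefficients. Degrees stay below d because a lies outside U. *)
Lemma hookpoly_weighted (phi : nat -> K) h :
  \sum_(U : {set 'I_d}) \sum_(a in ~: U) (-1) ^+ #|U| * phi #|U| * AB (a |: U) (~: U) h =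
  \sum_(k < d) (hookpoly K h)`_k * phi k.
Proof.
rewrite /hookpoly.
under [RHS]eq_bigr do rewrite coef_sum mulr_suml.
rewrite exchange_big /=; apply: eq_bigr => U _.
under [RHS]eq_bigr do rewrite coef_sum mulr_suml.
rewrite exchange_big /=; apply: eq_bigr => a; rewrite inE => aU.
have lt : (#|U| < d)%N.
  by have := max_card (mem (a |: U)); rewrite card_ord cardsU1 aU add1n.
have cE (k : nat) : ((- 'X) ^+ #|U| * (AB (a |: U) (~: U) h)%:P)`_k =
    (-1) ^+ #|U| * AB (a |: U) (~: U) h *+ (k == #|U|) :> K.
  rewrite coefMC -scaleN1r exprZn coefZ coefXn.
  by case: eqP; rewrite ?mulr1 ?mulr1n // !mulr0 mul0r mulr0n.
rewrite (bigD1 (Ordinal lt)) //= cE eqxx mulr1n mulrAC big1 ?addr0 // => k.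
by rewrite -val_eqE /= cE => /negbTE->; rewrite mulr0n mul0r.
Qed.

Lemma hookpoly_type s (beta : seq nat) (Q : {poly K}) : has_cycle_type s beta ->
  sumn beta = d -> (1 - 'X) * Q = \prod_(b <- beta) (1 - 'X^b) ->
  hookpoly K s = d%:R *: Q.
Proof.
move=> st sb eQ; apply: (mulfI (poly_1BX_neq0 K)).
rewrite hookpoly_cycles card_ord -scalerAr eQ scaler_nat mulr_natl; congr (_ *+ _).
by apply: (@prod_porbits d {poly K} s beta (fun i => 1 - 'X^i)) => //; rewrite -sb leq_sumn.
Qed.

Lemma has_cycle_typeV s beta : has_cycle_type s^-1%g beta = has_cycle_type s beta.
Proof. by rewrite /has_cycle_type porbitsV. Qed.

Lemma hookpoly_horner1 h : (hookpoly K h).[1] =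
  \sum_(U : {set 'I_d}) \sum_(a in ~: U) (-1) ^+ #|U| * AB (a |: U) (~: U) h.
Proof.
rewrite horner_sum; apply: eq_bigr => U _; rewrite horner_sum; apply: eq_bigr => a _.
by rewrite hornerM hornerC horner_exp hornerN hornerX.
Qed.

(** For fixed s of type beta, [hookpoly] at 1 replaces the indicator of d-cycles, and the sums over
    permutations with m cycles and over transpositions act on each hook term by scalars. What
    remains is a weighted sum of coefficients of [hookpoly] at s^-1, the same for all s of that
    type. *)
Theorem hurwitz_countE t m (beta : seq nat) (Q : {poly K}) :
  sumn beta = d -> (1 - 'X) * Q = \prod_(b <- beta) (1 - 'X^b) ->
  d%:R * (hurwitz_count d t m beta)%:R =
  #|[set s : G | has_cycle_type s beta]|%:R *
    \sum_(k < d) Q`_k * (eigval k d.-1 ^+ t * eigval k m).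
Proof.
move=> sb eQ; have dK : d%:R != 0 :> K by rewrite pnatr_eq0 -lt0n.
(* A second factor d is introduced because [hookpoly] takes the value d^2 at 1 on d-cycles. *)
apply: (mulfI dK).
pose P1 (f : {ffun 'I_t -> G}) := [forall j, is_transposition (f j)].
have -> : (hurwitz_count d t m beta)%:R =
    \sum_(s : G | has_cycle_type s beta) \sum_(f | P1 f)
      \sum_(s0 : G | #|porbits (s0 * (\prod_(j < t) f j) * s)%g| == m)
         (is_full_cycle s0)%:R :> K.
  pose cond s0 f s := [&& is_full_cycle s0, P1 f, has_cycle_type s beta &
     #|porbits (s0 * (\prod_(j < t) f j) * s)%g| == m].
  transitivity (\sum_s \sum_f \sum_s0 (cond s0 f s)%:R : K).
    rewrite /hurwitz_count -sum1_card natr_sum big_mkcond /=.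
    under [RHS]eq_bigr do rewrite exchange_big pair_big /=.
    rewrite exchange_big pair_big /=; apply: eq_bigr => p _.
    by rewrite inE -/(P1 _) -/(cond p.1.1 p.1.2 p.2); case: cond.
  rewrite [RHS]big_mkcond; apply: eq_bigr => s _ /=; case: ifP => st; last first.
    by rewrite big1 // => f _; rewrite big1 // => s0 _; rewrite /cond st !andbF.
  rewrite [RHS]big_mkcond; apply: eq_bigr => f _ /=; case: ifP => Pf; last first.
    by rewrite big1 // => s0 _; rewrite /cond Pf !andbF.
  rewrite [RHS]big_mkcond; apply: eq_bigr => s0 _ /=; rewrite /cond st Pf /=.
  by case: ifP => _; rewrite ?andbT ?andbF.
rewrite mulrA -expr2 mulr_sumr.
have key s : has_cycle_type s beta ->
    d%:R ^+ 2 * (\sum_(f | P1 f)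
      \sum_(s0 : G | #|porbits (s0 * (\prod_(j < t) f j) * s)%g| == m)
         (is_full_cycle s0)%:R) =
    d%:R * \sum_(k < d) Q`_k * (eigval k d.-1 ^+ t * eigval k m) :> K.
  move=> st.
  have -> : d%:R * (\sum_(k < d) Q`_k * (eigval k d.-1 ^+ t * eigval k m)) =
      \sum_(k < d) (hookpoly K s^-1%g)`_k * (eigval k d.-1 ^+ t * eigval k m).
    rewrite mulr_sumr; apply: eq_bigr => k _.
    by rewrite (@hookpoly_type _ beta Q) ?has_cycle_typeV // coefZ mulrA.
  rewrite -(hookpoly_weighted (fun k => eigval k d.-1 ^+ t * eigval k m)).
  rewrite mulr_sumr.
  transitivity (\sum_(f | P1 f) \sum_(g : G | #|porbits g| == m)
      \sum_(U : {set 'I_d}) \sum_(a in ~: U)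
        (-1) ^+ #|U| * AB (a |: U) (~: U) (g * (\prod_(j < t) f j * s)^-1)%g : K).
    apply: eq_bigr => f _.
    (* Substituting s0 = g (tau s)^-1, with tau the product of the transpositions, turns the
       condition into g having m cycles. *)
    rewrite mulr_sumr (reindex_inj (mulIg (\prod_(j < t) f j * s)^-1%g)) /=.
    apply: eq_big => [g|g _]; first by rewrite -[X in porbits X]mulgA mulgKV.
    rewrite -hookpoly_horner1 hookpoly1 card_ord // is_full_cycleE //.
    by rewrite mulr_natr.
  under eq_bigr do rewrite exchange_big.
  rewrite exchange_big; apply: eq_bigr => U _ /=.
  under eq_bigr do rewrite exchange_big.
  rewrite exchange_big; apply: eq_bigr => a /=; rewrite inE => aU.
  under eq_bigr do rewrite -mulr_sumr hook_eigenl // invMg.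
  by rewrite -!mulr_sumr sum_AB_transpositions // -!mulrA [eigval _ m * _]mulrCA.
rewrite (eq_bigr _ key) sumr_const mulrCA [RHS]mulr_natl; congr (_ *+ _).
by apply: eq_card => s; rewrite !inE.
Qed.

End Count.

Section Cancel.

Import mathcomp.algebra_tactics.ring.
Local Open Scope ring_scope.

Lemma cancel_factors (F : fieldType) (e1 e2 w q b y v : F) :
  e1 != 0 -> w != 0 -> y != 0 ->
  e1^-1 / w * y * (e1 * e2 * (w * q) * (b * (y^-1 * v))) = e2 * q * (b * v).
Proof. by move=> e10 w0 y0; field; rewrite ?e10 ?w0 ?y0. Qed.

End Cancel.

(** * Circle integrals *)

Unset Implicit Arguments.

Local Open Scope R_scope.

(* Coquelicot states equalities in [R_NormedModule], where [ring] and [field] fail. *)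
Ltac eqR := match goal with |- @eq _ ?x ?y => change (@eq R x y) end.

(* The real part of [exp (b e^(i th)) e^(i (p - s th))]; the phase [p = - PI / 2]
   gives the imaginary part for [p = 0]. *)
Definition circ_fun (b s p th : R) := exp (b * cos th) * cos (b * sin th - s * th + p).

Lemma circ_fun_continuous b s p th : continuous (circ_fun b s p) th.
Proof. by apply: ex_derive_continuous; rewrite /circ_fun; auto_derive. Qed.

Lemma is_RInt_eq_val (f : R -> R) (a b l l' : R) :
  is_RInt f a b l -> l = l' -> is_RInt f a b l'.
Proof. by move=> ? <-. Qed.

(** The integrand is the derivative of F, which agrees at both ends because t is an integer. This is
    the recurrence b I_(t-1) = t I_t for the integrals I_s of [circ_fun b s p]. *)
Lemma is_RInt_circ_step b p (t : nat) :
  is_RInt (fun th => b * circ_fun b (INR t - 1) p th - INR t * circ_fun b (INR t) p th)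
    0 (2 * PI) 0.
Proof.
pose F th := exp (b * cos th) * sin (b * sin th - INR t * th + p).
apply: (@is_RInt_eq_val _ _ _ (minus (F (2 * PI)) (F 0))); last first.
  rewrite /F /minus /plus /Hierarchy.opp /= sin_0 cos_0 cos_2PI sin_2PI.
  have -> : b * 0 - INR t * 0 + p = p by ring.
  have -> : sin p = sin (b * 0 - INR t * (2 * PI) + p).
    rewrite -[RHS](sin_period _ t); congr sin; ring.
  ring.
apply: is_RInt_derive => th _; last first.
  apply: (continuous_minus (V := R_NormedModule)).
    by apply: (continuous_scal_r (V := R_NormedModule)); apply: circ_fun_continuous.
  by apply: (continuous_scal_r (V := R_NormedModule)); apply: circ_fun_continuous.
rewrite /F /circ_fun; auto_derive => //.
have -> : b * sin th - (INR t - 1) * th + p = (b * sin th - INR t * th + p) + th by ring.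
rewrite [cos (_ + th)]cos_plus /Rminus; ring.
Qed.

Lemma circ_fun_derive_b p th b :
  is_derive (fun u => circ_fun u 0 p th) b (circ_fun b (-1) p th).
Proof.
rewrite /circ_fun; auto_derive => //.
have -> : b * sin th - -1 * th + p = (b * sin th - 0 * th + p) + th by ring.
rewrite [cos (_ + th)]cos_plus /Rminus; ring.
Qed.

(** For nonzero b this is the recurrence at t = 0; for b = 0 the integrand is cos (th + p). *)
Lemma is_RInt_circ_neg1 b p : is_RInt (circ_fun b (-1) p) 0 (2 * PI) 0.
Proof.
case: (Req_dec b 0) => [->|b0].
  apply: (@is_RInt_eq_val _ _ _ (minus (sin (2 * PI + p)) (sin (0 + p)))); last first.
    rewrite /minus /plus /Hierarchy.opp /= -[sin (0 + p)](sin_period _ 1) /=.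
    have -> : 0 + p + 2 * 1 * PI = 2 * PI + p by ring.
    ring.
  apply: (is_RInt_derive (fun th => sin (th + p))) => th _; last exact: circ_fun_continuous.
  rewrite /circ_fun; auto_derive => //.
  by rewrite !Rmult_0_l exp_0; have -> : 0 - -1 * th + p = th + p by ring.
have := is_RInt_scal _ _ _ (/ b) _ (is_RInt_circ_step b p 0).
rewrite /scal /= /mult /= Rmult_0_r; apply: is_RInt_ext => th _.
rewrite /scal /= /mult /=; eqR; have -> : 0 - 1 = -1 by ring.
by field.
Qed.

(** A mean value property: the derivative of the integral in b is the integral with s = -1, which
    vanishes, so b may be replaced by 0. *)
Lemma is_RInt_circ0 b p : is_RInt (circ_fun b 0 p) 0 (2 * PI) (2 * PI * cos p).
Proof.
pose J u := RInt (circ_fun u 0 p) 0 (2 * PI).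
have exI u : ex_RInt (circ_fun u 0 p) 0 (2 * PI).
  by apply: ex_RInt_continuous => z _; apply: circ_fun_continuous.
have dJ u : is_derive J u 0.
  have e0 : RInt (fun th => Derive (fun v => circ_fun v 0 p th) u) 0 (2 * PI) = 0.
    rewrite -[RHS](is_RInt_unique _ _ _ _ (is_RInt_circ_neg1 u p)).
    by apply: RInt_ext => th _; rewrite (is_derive_unique _ _ _ (circ_fun_derive_b p th u)).
  rewrite -[X in is_derive _ _ X]e0; apply: is_derive_RInt_param.
  - by apply: filter_forall => v th _; eexists; apply: circ_fun_derive_b.
  - move=> th _; apply: (continuity_2d_pt_ext (fun u v => circ_fun u (-1) p v)).
      by move=> x y; rewrite (is_derive_unique _ _ _ (circ_fun_derive_b p y x)).
    have cid2 f : continuity_pt f th -> continuity_2d_pt (fun _ v => f v) u th.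
      move=> cf; apply: (continuity_1d_2d_pt_comp f (fun _ v => v)) => //.
      exact: continuity_2d_pt_id2.
    apply: continuity_2d_pt_mult.
      apply: (continuity_1d_2d_pt_comp exp (fun u v => u * cos v)).
        by apply: derivable_continuous_pt; apply: derivable_pt_exp.
      apply: continuity_2d_pt_mult; first exact: continuity_2d_pt_id1.
      by apply: cid2; apply: continuity_cos.
    apply: (continuity_1d_2d_pt_comp cos (fun u v => u * sin v - -1 * v + p)).
      exact: continuity_cos.
    apply: continuity_2d_pt_plus; last exact: continuity_2d_pt_const.
    apply: continuity_2d_pt_minus; apply: continuity_2d_pt_mult.
    + exact: continuity_2d_pt_id1.
    + by apply: cid2; apply: continuity_sin.
    + exact: continuity_2d_pt_const.
    + exact: continuity_2d_pt_id2.
  - by apply: filter_forall.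
have J0 : J 0 = 2 * PI * cos p.
  rewrite /J (RInt_ext _ (fun=> cos p)) ?RInt_const /scal /= /mult /=; first by ring.
  by move=> th _; rewrite /circ_fun !Rmult_0_l exp_0 Rmult_1_l; congr cos; ring.
have JE : J b = J 0.
  have key u v : u < v -> J u = J v.
    by move=> uv; apply: (eq_is_derive J u v) => // w _; apply: dJ.
  by case: (Rtotal_order b 0) => [/key|[->|/key]].
rewrite -J0 -JE; exact: RInt_correct.
Qed.

Lemma INR_fact_neq0 n : INR n`! <> 0.
Proof. by apply: not_0_INR; apply/eqP; rewrite -lt0n fact_gt0. Qed.

Lemma is_RInt_circ b p (t : nat) :
  is_RInt (circ_fun b (INR t) p) 0 (2 * PI) (2 * PI * cos p * b ^ t / INR t`!).
Proof.
elim: t => [|t IH].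
  apply: is_RInt_eq_val (is_RInt_circ0 b p) _.
  by rewrite /=; field.
have H := is_RInt_circ_step b p t.+1.
have tE : INR t.+1 - 1 = INR t by rewrite S_INR; ring.
have t0 : INR t.+1 <> 0 by apply: not_0_INR.
rewrite tE in H.
have H2 := is_RInt_scal _ _ _ (/ INR t.+1) _
  (is_RInt_minus _ _ _ _ _ _ (is_RInt_scal _ _ _ b _ IH) H).
apply: is_RInt_eq_val (is_RInt_ext _ _ _ _ _ _ H2) _ => [th _|].
  rewrite /scal /minus /plus /Hierarchy.opp /= /mult /= -/(INR t.+1); eqR.
  by move: (INR t.+1) t0 => u u0; field.
rewrite factS mult_INR /scal /minus /plus /Hierarchy.opp /= /mult /= -/(INR t.+1); eqR.
have f0 := INR_fact_neq0 t.
by move: (INR t.+1) t0 => u u0; field.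
Qed.

(** * Derivatives of powers times logarithms *)

(** The coefficient of u^j in x^(e + u); with the factorial, differentiation lowers j without a
    numerical factor. *)
Definition pwlog (e : R) (j : nat) (x : R) : R := Rpower x e * ln x ^ j / INR j`!.

Lemma Rpower_pred x e : 0 < x -> Rpower x (e - 1) = Rpower x e / x.
Proof. by move=> x0; rewrite /Rminus Rpower_plus Rpower_Ropp Rpower_1. Qed.

Lemma is_derive_pwlog e j x : 0 < x ->
  is_derive (pwlog e j) x
    (e * pwlog (e - 1) j x + (if j is j'.+1 then pwlog (e - 1) j' x else 0)).
Proof.
move=> x0; rewrite /pwlog Rpower_pred //.
have dP : is_derive (fun y => Rpower y e) x (e * (Rpower x e / x)).
  rewrite -Rpower_pred //; apply/is_derive_Reals; exact: derivable_pt_lim_power.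
have dL : is_derive (fun y => ln y ^ j / INR j`!) x
    (if j is j'.+1 then ln x ^ j' / INR j'`! / x else 0).
  case: j => [|j]; first by apply: (is_derive_ext (fun=> 1 / INR 0`!)) => //; apply: is_derive_const.
  have f0 := INR_fact_neq0 j; have j0 : INR j.+1 <> 0 by apply: not_0_INR.
  rewrite factS mult_INR; auto_derive => //.
  rewrite -[match j with 0%N => 1 | _ => INR j + 1 end]/(INR j.+1).
  by move: (INR j.+1) j0 => u u0; field; repeat split => //; lra.
apply: is_derive_ext (fun y => Rpower y e * (ln y ^ j / INR j`!)) _ _ _ _ _.
  by move=> y; rewrite /Rdiv Rmult_assoc.
have := is_derive_mult _ _ _ _ _ dP dL Rmult_comm.
rewrite /plus /mult /=.
set u := (X in is_derive _ _ X -> _); set v := (X in _ -> is_derive _ _ X).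
suff -> : u = v by [].
rewrite /u /v; eqR; have f0 := INR_fact_neq0 j.
case: j {dL u v} f0 => [|j] f0; first by field; lra.
have f1 := INR_fact_neq0 j; field; repeat split => //; lra.
Qed.

Lemma is_derive_bigsum n (f : nat -> R -> R) (df : nat -> R) x :
  (forall i, (i < n)%N -> is_derive (f i) x (df i)) ->
  is_derive (fun y => \big[Rplus/0]_(i < n) f i y) x (\big[Rplus/0]_(i < n) df i).
Proof.
elim: n => [|n IH] H.
  apply: (is_derive_ext (fun=> 0)); first by move=> y; rewrite big_ord0.
  by rewrite big_ord0; apply: is_derive_const.
apply: (is_derive_ext (fun y => \big[Rplus/0]_(i < n) f i y + f n y)).
  by move=> y; rewrite big_ord_recr.
rewrite big_ord_recr /=; apply: is_derive_plus; last exact: H.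
by apply: IH => i lin; apply: H; rewrite ltnS ltnW.
Qed.

(** The n-th derivative of [pwlog c m]: that of x^(c + u) is [ffpoly c n] at u times x^(c - n + u),
    and the sum is its coefficient of u^m. *)
Definition pwlog_D (c : R) (m n : nat) (x : R) : R :=
  \big[Rplus/0]_(i < m.+1) (nth 0 (ffpoly c n) i * pwlog (c - INR n) (m - i) x).

Lemma ffpolyS_coef (c : R) n i :
  nth 0 (ffpoly c n.+1) i =
  (if i is i'.+1 then nth 0 (ffpoly c n) i' else 0) + (c - INR n) * nth 0 (ffpoly c n) i.
Proof.
rewrite /ffpoly big_ord_recr /= mulrDr coefD coefMX coefMC INRE mulrC.
by case: i.
Qed.

Lemma is_derive_pwlog_D c m n x : 0 < x ->
  is_derive (pwlog_D c m n) x (pwlog_D c m n.+1 x).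
Proof.
move=> x0.
pose f i y := nth 0 (ffpoly c n) i * pwlog (c - INR n) (m - i) y.
pose df i := nth 0 (ffpoly c n) i * ((c - INR n) * pwlog (c - INR n - 1) (m - i) x +
    (if (m - i)%N is j'.+1 then pwlog (c - INR n - 1) j' x else 0)).
have := @is_derive_bigsum m.+1 f df x.
suff -> : \big[Rplus/0]_(i < m.+1) df i = pwlog_D c m n.+1 x.
  apply=> i _; apply: is_derive_scal; exact: is_derive_pwlog.
rewrite /pwlog_D.
have e : c - INR n - 1 = c - INR n.+1 by rewrite S_INR; ring.
rewrite /df e.
under [RHS]eq_bigr => i _ do rewrite ffpolyS_coef Rmult_plus_distr_r.
rewrite [RHS]big_split /=.
under [LHS]eq_bigr => i _ do rewrite Rmult_plus_distr_l.
rewrite big_split /= Rplus_comm; congr (_ + _).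
  (* The last term on the left and the first on the right vanish, and the rest match after shifting
     i by one. *)
  rewrite big_ord_recr /= subnn Rmult_0_r Rplus_0_r [RHS]big_ord_recl Rmult_0_l Rplus_0_l.
  apply: eq_bigr => i _ /=; congr (_ * _).
  by rewrite -[in LHS](subSS i m) subSn ?ltn_ord // /bump /= add1n.
by apply: eq_bigr => i _; ring.
Qed.

Lemma Derive_n_chain (F : nat -> R -> R) :
  (forall n x, 0 < x -> is_derive (F n) x (F n.+1 x)) ->
  forall n x, 0 < x -> ex_derive_n (F 0%N) n x /\ Derive_n (F 0%N) n x = F n x.
Proof.
move=> dF; elim=> [|n IH] x x0; first by [].
have pos : locally x (fun y => 0 < y) by apply: open_gt.
have loc : locally x (fun y => F n y = Derive_n (F 0%N) n y).
  by apply: filter_imp pos => y /IH[_ ->].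
have d : is_derive (Derive_n (F 0%N) n) x (F n.+1 x).
  by apply: is_derive_ext_loc loc (dF n x x0).
split; first by exists (F n.+1 x).
exact: is_derive_unique.
Qed.

Lemma pwlog_at1 e j : pwlog e j 1 = if j is 0 then 1 else 0.
Proof.
rewrite /pwlog ln_1 /Rpower ln_1 Rmult_0_r exp_0.
case: j => [|j] /=; first by field.
by rewrite Rmult_0_l Rmult_0_r /Rdiv Rmult_0_l.
Qed.

Lemma pwlog_D_at1 c m n : pwlog_D c m n 1 = nth 0 (ffpoly c n) m.
Proof.
rewrite /pwlog_D big_ord_recr /= subnn pwlog_at1 Rmult_1_r big1 ?Rplus_0_l //.
move=> i _; rewrite pwlog_at1; have := ltn_ord i; rewrite -subn_gt0.
by case: (m - i)%N => // k _; rewrite Rmult_0_r.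
Qed.

Lemma pwlog_D0 c m x : pwlog_D c m 0 x = pwlog c m x.
Proof.
rewrite /pwlog_D /ffpoly big_ord0 big_ord_recl /= coef1 subn0 Rminus_0_r Rmult_1_l.
by rewrite big1 ?Rplus_0_r // => i _; rewrite coef1 /= Rmult_0_l.
Qed.

Lemma Derive_n_pwlog_sum n (a c : nat -> R) m d :
  let F x := \big[Rplus/0]_(k < n) (a k * pwlog (c k) m x) in
  ex_derive_n F d 1 /\
  Derive_n F d 1 = \big[Rplus/0]_(k < n) (a k * nth 0 (ffpoly (c k) d) m).
Proof.
pose G j x := \big[Rplus/0]_(k < n) (a k * pwlog_D (c k) m j x).
have dG j x : 0 < x -> is_derive (G j) x (G j.+1 x).
  move=> x0; apply: (@is_derive_bigsum n (fun k y => a k * pwlog_D (c k) m j y)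
     (fun k => a k * pwlog_D (c k) m j.+1 x)) => i _.
  by apply: is_derive_scal; apply: is_derive_pwlog_D.
have G0 x : G 0%N x = \big[Rplus/0]_(k < n) (a k * pwlog (c k) m x).
  by apply: eq_bigr => k _; rewrite pwlog_D0.
have [ex D] := Derive_n_chain G dG d 1 Rlt_0_1.
move=> F; split.
  by apply: ex_derive_n_ext ex => x; rewrite G0.
rewrite -(Derive_n_ext _ _ d 1 G0) D.
by apply: eq_bigr => k _; rewrite pwlog_D_at1.
Qed.

(** * The Laurent coefficient *)

Set Implicit Arguments.

(** * The complex numbers as a field *)

HB.instance Definition _ := Choice.copy C (R * R)%type.

HB.instance Definition _ :=
  GRing.isZmodule.Build C Cplus_assoc Cplus_comm Cplus_0_l
    (fun x => etrans (Cplus_comm _ _) (Cplus_opp_r x)).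

Lemma C1_neq0 : RtoC 1 != RtoC 0.
Proof. by apply/eqP=> /RtoC_inj; exact: R1_neq_R0. Qed.

HB.instance Definition _ :=
  GRing.Zmodule_isComNzRing.Build C Cmult_assoc Cmult_comm Cmult_1_l
    (fun x y z => Cmult_plus_distr_r x y z) C1_neq0.

Lemma Cmul_inv_l (x : C) : x != RtoC 0 -> Cmult (Cinv x) x = RtoC 1.
Proof. by move/eqP=> x0; rewrite Cmult_comm Cinv_r. Qed.

Lemma Cinv_0 : Cinv (RtoC 0) = RtoC 0.
Proof. by rewrite /Cinv /RtoC /= /Rdiv Ropp_0 !Rmult_0_l. Qed.

HB.instance Definition _ := GRing.ComNzRing_isField.Build C Cmul_inv_l Cinv_0.

HB.instance Definition _ := GRing.isZmodMorphism.Build R C RtoC RtoC_minus.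
HB.instance Definition _ := GRing.isMonoidMorphism.Build R C RtoC
   (conj (erefl : RtoC 1%R = 1%R) RtoC_mult).

(** * The integrand as an exponential polynomial *)

Section CircleIntegrand.

Local Open Scope ring_scope.
Local Arguments Cexp z%_ring_scope.

Lemma pow_nE (z : C) n : pow_n z n = z ^+ n.
Proof. by elim: n => [|n IH] //=; rewrite exprS -IH. Qed.

Lemma CexpD (z1 z2 : C) : Cexp (z1 + z2) = Cexp z1 * Cexp z2.
Proof.
rewrite /Cexp; case: z1 z2 => [a b] [a' b'].
apply: injective_projections; rewrite /= exp_plus ?cos_plus ?sin_plus; eqR; ring.
Qed.

Lemma Cexp0 : Cexp 0 = 1.
Proof. by rewrite /Cexp /= exp_0 cos_0 sin_0 Rmult_1_l Rmult_0_r. Qed.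

Lemma Cexp_neq0 z : Cexp z != 0.
Proof.
apply/negP=> /eqP e; have : Cexp (z + - z) = 1 by rewrite subrr Cexp0.
by rewrite CexpD e mul0r => /eqP; rewrite eq_sym oner_eq0.
Qed.

Lemma CexpN z : Cexp (- z) = (Cexp z)^-1.
Proof. by apply: (mulfI (Cexp_neq0 z)); rewrite -CexpD subrr Cexp0 divff ?Cexp_neq0. Qed.

Lemma CexpMn z n : Cexp (z *+ n) = Cexp z ^+ n.
Proof. by elim: n => [|n IH]; rewrite ?mulr0n ?Cexp0 // mulrS CexpD IH exprS. Qed.

Lemma Cexp_RtoC a : Cexp (RtoC a) = RtoC (exp a).
Proof. by rewrite /Cexp /= cos_0 sin_0 Rmult_0_r Rmult_1_r. Qed.

Lemma Cpowz_nat (u : C) n : Cpowz u (Z.of_nat n) = u ^+ n.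
Proof. by case: n => [|n] //; rewrite /Cpowz /= SuccNat2Pos.id_succ pow_nE. Qed.

Lemma Cpowz_opp (u : C) n : Cpowz u (- Z.of_nat n) = u ^- n.
Proof.
by case: n => [|n]; rewrite ?expr0 ?invr1 // /Cpowz /= SuccNat2Pos.id_succ pow_nE.
Qed.

Lemma Cpowz_pred (u : C) n : u != 0 -> Cpowz u (Z.of_nat n - 1) = u^-1 * u ^+ n.
Proof.
move=> u0; case: n => [|n]; first by rewrite (Cpowz_opp u 1) expr1 mulr1.
have -> : Z.sub (Z.of_nat n.+1) 1 = Z.of_nat n by lia.
by rewrite Cpowz_nat exprS mulKf.
Qed.

(** With p = n - 1, the power of y left by the sinh product combines with y^(-k) into y^(-t). As k
    may be negative, its sign is distinguished. *)
Lemma Cpowz_shift (u : C) (p t : nat) (k : Z) : u != 0 ->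
  Z.of_nat t = Z.add (Z.of_nat p) k -> (u ^+ p)^-1 * Cpowz u (Z.opp k) = u ^- t.
Proof.
move=> u0 tk; case: (Z.le_gt_cases 0 k) => k0.
  have ek : k = Z.of_nat (Z.to_nat k) by lia.
  have -> : t = (p + Z.to_nat k)%N by lia.
  by have := Cpowz_opp u (Z.to_nat k); rewrite -ek => ->; rewrite exprD invfM.
have ek : Z.opp k = Z.of_nat (Z.to_nat (Z.opp k)) by lia.
have -> : p = (t + Z.to_nat (Z.opp k))%N by lia.
by rewrite [in Cpowz _ _]ek Cpowz_nat exprD invfM mulfVK // expf_neq0.
Qed.

Section Integrand.

Variables (d : nat) (beta : seq nat) (x : R) (y : C).
Hypotheses (d_gt0 : (0 < d)%N) (beta_pos : all (fun b => 0 < b)%N beta).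
Hypotheses (sum_beta : sumn beta = d).
Let L := RtoC (ln x).
Let z : C := L + y.
Let W := Cexp (- z).

Definition sinh_factor (i : nat) : C :=
  Cdiv (Csinh (Cplus (RtoC (INR i / 2 * ln x)) (Cmult (RtoC (INR i / 2)) y)))
       (Cmult (RtoC (INR i / 2)) y).

(** With u = i z / 2, sinh u = e^u (1 - e^(-2u)) / 2 and e^(-2u) = W^i; the halves cancel. *)
Lemma sinh_factorE i : (0 < i)%N ->
  sinh_factor i = Cexp (RtoC (INR i / 2) * z) * (1 - W ^+ i) / (i%:R * y).
Proof.
move=> i0; rewrite /sinh_factor.
have -> : Cplus (RtoC (INR i / 2 * ln x)) (Cmult (RtoC (INR i / 2)) y) = RtoC (INR i / 2) * z.
  by rewrite RtoC_mult mulrDr.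
set u := RtoC (INR i / 2) * z.
have eW : W ^+ i = Cexp (- u) * Cexp (- u).
  rewrite -CexpD -CexpMn; congr Cexp; rewrite -opprD mulNrn; congr (- _).
  rewrite /u -mulrDl -rmorphD /= -mulr_natl; congr (_ * _).
  have e2 : Rplus (Rdiv (INR i) 2) (Rdiv (INR i) 2) = INR i by field.
  by rewrite -[i%:R](rmorph_nat RtoC) -INRE; congr RtoC; rewrite -[LHS]e2.
have iE : i%:R = RtoC (INR i) :> C by rewrite INRE rmorph_nat.
have i0' : RtoC (INR i) != 0.
  by apply/eqP=> /RtoC_inj; apply: not_0_INR; apply/eqP; rewrite -lt0n.
change ((Cexp u - Cexp (- u)) * RtoC (Rinv 2) * (RtoC (Rdiv (INR i) 2) * y)^-1 =
        Cexp u * (1 - W ^+ i) / (i%:R * y)).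
rewrite eW mulrBr mulr1 mulrA -CexpD subrr Cexp0 mul1r.
rewrite iE -!mulrA; congr (_ * _).
rewrite !invfM mulrA; congr (_ * _).
have h2 : RtoC 2 != 0 by apply/eqP=> /RtoC_inj; lra.
have -> : RtoC (INR i / 2) = RtoC (INR i) * RtoC (/ 2) by rewrite -rmorphM.
have -> : RtoC (/ 2) = (RtoC 2)^-1 by rewrite RtoC_inv.
by rewrite invfM invrK mulrCA mulVf ?mulr1.
Qed.

Lemma prod_sinh_factor s : all (fun b => 0 < b)%N s -> y != 0 ->
  \prod_(b <- s) sinh_factor b =
  Cexp (RtoC (INR (sumn s) / 2) * z) * (\prod_(b <- s) (1 - W ^+ b)) /
  ((\prod_(b <- s) b)%:R * y ^+ size s).
Proof.
move=> + y0; elim: s => [|b s IH] /= => [_|/andP[b0 /IH e]].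
  by rewrite !big_nil /Rdiv Rmult_0_l mul0r Cexp0 !mul1r invr1.
rewrite !big_cons e sinh_factorE // plus_INR.
have -> : RtoC ((INR b + INR (sumn s)) / 2) = RtoC (INR b / 2) + RtoC (INR (sumn s) / 2).
  by rewrite -rmorphD /= /Rdiv Rmult_plus_distr_r.
rewrite mulrDl CexpD exprS natrM.
rewrite [in RHS](_ : _ * _ * (y * _) = b%:R * y * ((\prod_(j <- s) j)%:R * y ^+ size s)).
  by rewrite mulf_div mulrACA.
by rewrite -!mulrA; congr (_ * _); rewrite mulrCA.
Qed.

Lemma foldr_Cpowz : sinh_factor 1 != 0 ->
  foldr Cmult (RtoC 1) [seq Cpowz (sinh_factor i) (cexp beta i) | i <- iota 1 d] =
  (sinh_factor 1)^-1 * \prod_(b <- beta) sinh_factor b.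
Proof.
move=> f1.
have le : all (fun b => b < d.+1)%N beta by rewrite -sum_beta leq_sumn.
rewrite (big_mult sinh_factor le) big_ord_recl mult0 // expr0 mul1r.
transitivity (\prod_(i <- iota 1 d) Cpowz (sinh_factor i) (cexp beta i)).
  by rewrite foldrE big_map.
have -> : iota 1 d = index_iota 1 d.+1 by rewrite /index_iota subSS subn0.
rewrite big_add1 /= big_mkord; case: d d_gt0 => // d' _.
rewrite !big_ord_recl /= mulrA; congr (_ * _).
  by rewrite /cexp eqxx Cpowz_pred.
by apply: eq_bigr => i _; rewrite /cexp /= Cpowz_nat.
Qed.

(** Up to the product of the parts, the product over beta is e^(d z / 2) (1 - W) Q(W) / y^n.
    Dividing by the factor e^(z / 2) (1 - W) / y of i = 1, as c_1 = a_1 - 1 demands, cancels 1 - W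
    and leaves e^((d - 1) z / 2) Q(W) / y^(n - 1). *)
Lemma foldr_sinh (Q : {poly R}) : y != 0 -> W != 1 ->
    (1 - 'X) * Q = \prod_(b <- beta) (1 - 'X^b) -> (size Q <= d)%N ->
  foldr Cmult (RtoC 1) [seq Cpowz (sinh_factor i) (cexp beta i) | i <- iota 1 d] =
  (\sum_(j < d) RtoC (nth (IZR 0) Q j) * Cexp (RtoC ((INR d - 1) / 2 - INR j) * z)) /
  ((\prod_(b <- beta) b)%:R * y ^+ (size beta).-1).
Proof.
move=> y0 W1 eQ szQ.
have f1E : sinh_factor 1 = Cexp (RtoC (1 / 2) * z) * (1 - W) / y.
  by rewrite sinh_factorE // expr1 mul1r.
have W1' : 1 - W != 0 by rewrite subr_eq0 eq_sym.
have f1 : sinh_factor 1 != 0.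
  by rewrite f1E !mulf_neq0 ?invr_neq0 ?Cexp_neq0.
rewrite foldr_Cpowz // prod_sinh_factor // sum_beta.
have eQW : \prod_(b <- beta) (1 - W ^+ b) = (1 - W) * (map_poly RtoC Q).[W].
  have /(congr1 (fun p => (map_poly RtoC p).[W])) := eQ.
  rewrite rmorphM rmorph_prod /= hornerM horner_prod rmorphB /= map_polyX rmorph1.
  rewrite hornerD hornerN hornerX hornerC => ->; apply: eq_bigr => b _.
  by rewrite rmorphB /= map_polyXn rmorph1 hornerD hornerN hornerXn hornerC.
have sz : size beta = (size beta).-1.+1.
  by case: beta sum_beta d_gt0 => //= <-.
rewrite eQW f1E {1}sz exprS.
have -> : Cexp (RtoC (INR d / 2) * z) =
    Cexp (RtoC (1 / 2) * z) * Cexp (RtoC ((INR d - 1) / 2) * z).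
  rewrite -CexpD -mulrDl -rmorphD /=; congr (Cexp (RtoC _ * z)).
  by change (Rdiv (INR d) 2 = Rplus (Rdiv 1 2) (Rdiv (Rminus (INR d) 1) 2)); field.
have -> : \sum_(j < d) RtoC (nth (IZR 0) Q j) * Cexp (RtoC ((INR d - 1) / 2 - INR j) * z) =
   Cexp (RtoC ((INR d - 1) / 2) * z) * (map_poly RtoC Q).[W].
  rewrite (@horner_coef_wide _ d) ?size_map_poly // mulr_sumr; apply: eq_bigr => j _.
  rewrite coef_map /= mulrCA; congr (_ * _).
  rewrite -CexpMn -CexpD; congr Cexp.
  have -> : RtoC ((INR d - 1) / 2 - INR j) = RtoC ((INR d - 1) / 2) - RtoC (INR j).
    by rewrite -rmorphB.
  by rewrite mulrBl mulNrn -[z *+ j]mulr_natl (INRE j) rmorph_nat.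
set E1 := Cexp (_ * z); set E2 := Cexp (_ * z); set q := _.[W]; set B := _%:R.
have E10 : E1 != 0 by apply: Cexp_neq0.
rewrite !invfM invrK.
exact: cancel_factors.
Qed.

End Integrand.

Definition Cimag (th : R) : C := (IZR 0, th).

Lemma CimagMn th n : Cimag th *+ n = Cimag (INR n * th).
Proof.
elim: n => [|n IH]; first by rewrite mulr0n /Cimag Rmult_0_l.
rewrite mulrSr IH S_INR; apply: injective_projections => /=; eqR; rewrite ?Rplus_0_l //.
by change (Rplus (Rmult (INR n) th) th = Rmult (Rplus (INR n) 1) th); ring.
Qed.

Lemma Cexp_polar (a r th : R) (t : nat) :
  let y : C := (Rmult r (cos th), Rmult r (sin th)) in
  let b := Rmult a r in
  Cexp (RtoC a * y) * y ^- t =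
  RtoC (/ r ^ t) * (circ_fun b (INR t) 0 th, circ_fun b (INR t) (- (PI / 2)) th).
Proof.
move=> y b.
have yE : y = RtoC r * Cexp (Cimag th).
  by rewrite /y /Cexp; apply: injective_projections; rewrite /= exp_0; eqR; ring.
have -> : y ^- t = RtoC (/ r ^ t) * Cexp (- Cimag (INR t * th)).
  by rewrite yE exprMn invfM CexpN -CimagMn CexpMn RpowE RinvE fmorphV rmorphXn.
rewrite mulrCA -CexpD; congr (_ * _).
have -> : RtoC a * y - Cimag (INR t * th) =
   ((Rmult b (cos th), Rminus (Rmult b (sin th)) (Rmult (INR t) th)) : C).
  by apply: injective_projections; rewrite /b /=; eqR; ring.
rewrite /Cexp /circ_fun /=; congr (_, Rmult _ _); first by rewrite Rplus_0_r.
by rewrite -[RHS]cos_neg -[LHS]cos_shift; congr cos; ring.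
Qed.

Lemma Re_sum n (f : 'I_n -> C) : Complex.Re (\sum_(j < n) f j) = \sum_(j < n) Complex.Re (f j).
Proof. by apply: (big_morph _ (op1 := +%R) (id1 := 0)). Qed.

Lemma Im_sum n (f : 'I_n -> C) : Complex.Im (\sum_(j < n) f j) = \sum_(j < n) Complex.Im (f j).
Proof. by apply: (big_morph _ (op1 := +%R) (id1 := 0)). Qed.

Lemma sin_eq0_small u : Rlt (Rabs u) 1 -> sin u = IZR 0 -> u = IZR 0.
Proof.
move=> /Rabs_def2[u1 u2] su; have := PI2_1 => pi1.
case: (Rtotal_order u 0) => [u0|[//|u0]].
  by have := sin_lt_0_var u ltac:(lra) u0; lra.
by have := sin_gt_0 u u0 ltac:(lra); lra.
Qed.

Lemma circ_integrandE (d m : nat) (beta : seq nat) (r x th : R) (k : Z) (t : nat)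
    (Q : {poly R}) :
  (0 < d)%N -> all (fun b => 0 < b)%N beta -> sumn beta = d ->
  Z.of_nat t = Z.add (Z.of_nat (size beta).-1) k ->
  (1 - 'X) * Q = \prod_(b <- beta) (1 - 'X^b) -> (size Q <= d)%N ->
  Rlt 0 x -> Rlt 0 r -> Rlt r 1 -> Rlt (Rabs (ln x)) r ->
  circ_integrand d m beta r k x th =
  \sum_(j < d) RtoC (nth (IZR 0) Q j / INR (\prod_(b <- beta) b) *
                     pwlog (INR d - 1 - INR j) m x * / r ^ t) *
    (circ_fun (((INR d - 1) / 2 - INR j) * r) (INR t) 0 th,
     circ_fun (((INR d - 1) / 2 - INR j) * r) (INR t) (- (PI / 2)) th).
Proof.
move=> d0 pos sb tk eQ szQ x0 r0 r1 xr.
rewrite /circ_integrand /Fbrace.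
set y : C := (_, _).
have y0 : y != 0.
  apply/eqP=> e; have e1 : Rmult r (cos th) = IZR 0 := congr1 fst e.
  have e2 : Rmult r (sin th) = IZR 0 := congr1 snd e.
  case/Rmult_integral: e1 => [|c0]; first by lra.
  case/Rmult_integral: e2 => [|s0]; first by lra.
  by have := sin2_cos2 th; rewrite c0 s0 /Rsqr; lra.
(* If e^(log x + y) = 1, the imaginary part of y, below 1 in absolute value, must vanish. Then y is
   r or -r and log x = -y, against |log x| < r. *)
have W1 : Cexp (- (RtoC (ln x) + y)) != 1.
  apply/eqP; rewrite CexpN => /(congr1 (fun u : C => u^-1)); rewrite invrK invr1 => e.
  have e1 : Rmult (exp (Rplus (ln x) (Rmult r (cos th)))) (cos (Rplus 0 (Rmult r (sin th)))) = IZR 1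
    := congr1 fst e.
  have e2 : Rmult (exp (Rplus (ln x) (Rmult r (cos th)))) (sin (Rplus 0 (Rmult r (sin th)))) = IZR 0
    := congr1 snd e.
  rewrite Rplus_0_l in e1 e2.
  case/Rmult_integral: e2 => [|/sin_eq0_small s0].
    by have := exp_pos (Rplus (ln x) (Rmult r (cos th))); lra.
  have {}s0 : sin th = IZR 0.
    have: Rmult r (sin th) = IZR 0.
      apply: s0; rewrite Rabs_mult (Rabs_pos_eq r); last by lra.
      have := SIN_bound th => sb'.
      have : Rle (Rabs (sin th)) 1 by apply: Rabs_le.
      by have := Rabs_pos (sin th); nra.
    by case/Rmult_integral; lra.
  rewrite s0 Rmult_0_r cos_0 Rmult_1_r in e1.
  have e3 : Rplus (ln x) (Rmult r (cos th)) = IZR 0 by apply: exp_inv; rewrite exp_0.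
  have := sin2_cos2 th; rewrite s0 /Rsqr => c2.
  have : cos th = IZR 1 \/ cos th = Ropp 1.
    have : Rmult (Rminus (cos th) 1) (Rplus (cos th) 1) = IZR 0 by lra.
    by case/Rmult_integral => ?; [left|right]; lra.
  move/Rabs_def2: xr => [xr1 xr2].
  by case=> c1; rewrite c1 in e3; lra.
have := foldr_sinh d0 pos sb y0 W1 eQ szQ.
rewrite /sinh_factor => ->.
set B := \prod_(b <- beta) b.
change (RtoC (Rpower x ((INR d - 1) / 2) * ln x ^ m / INR m`!) *
  ((\sum_(j < d) RtoC (nth (IZR 0) Q j) * Cexp (RtoC ((INR d - 1) / 2 - INR j) * (RtoC (ln x) + y))) /
  (B%:R * y ^+ (size beta).-1)) * Cpowz y (- k) =
  \sum_(j < d) RtoC (nth (IZR 0) Q j / INR B *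
                     pwlog (INR d - 1 - INR j) m x * / r ^ t) *
    (circ_fun (((INR d - 1) / 2 - INR j) * r) (INR t) 0 th,
     circ_fun (((INR d - 1) / 2 - INR j) * r) (INR t) (- (PI / 2)) th)).
rewrite invfM -!mulrA (Cpowz_shift y0 tk) mulrA mulr_sumr mulr_suml.
apply: eq_bigr => j _.
set a := Rminus (Rdiv _ _) _.
rewrite mulrDr CexpD -rmorphM /= Cexp_RtoC.
have := Cexp_polar a r th t; rewrite /= -/y => CP.
rewrite [in RHS]RtoC_mult -[Cmult]/( *%R) -[RHS]mulrA -CP.
have BE : RtoC (/ INR B) = B%:R^-1 by rewrite RinvE fmorphV INRE rmorph_nat.
rewrite -BE.
have -> : Rmult (Rdiv (nth (IZR 0) Q j) (INR B)) (pwlog (INR d - 1 - INR j) m x) =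
  Rmult (Rmult (Rmult (Rdiv (Rmult (Rpower x ((INR d - 1) / 2)) (ln x ^ m)) (INR m`!)) (nth (IZR 0) Q j))
   (exp (a * ln x))) (/ INR B).
  rewrite /pwlog.
  (* The exponent of x is (d - 1) / 2 from the prefactor plus a from e^(a log x). *)
  have -> : Rminus (Rminus (INR d) 1) (INR j) = Rplus (Rdiv (Rminus (INR d) 1) 2) a.
    by rewrite /a; field.
  rewrite Rpower_plus -[Rpower x a]/(exp (a * ln x)) /Rdiv; ring.
set P := Rdiv _ (INR m`!); set q := nth _ _ _; set e := exp _; set iB := Rinv (INR B).
have -> : RtoC (P * q * e * iB) = RtoC P * RtoC q * RtoC e * RtoC iB by rewrite -!rmorphM.
by rewrite -!mulrA; do 3 congr (_ * _); rewrite mulrCA.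
Qed.

Lemma RInt_bigsum n (a : nat -> R) (f : nat -> R -> R) (v : nat -> R) (u w : R) :
  (forall j, (j < n)%N -> is_RInt (f j) u w (v j)) ->
  RInt (fun th => \big[Rplus/IZR 0]_(j < n) (Rmult (a j) (f j th))) u w =
  \big[Rplus/IZR 0]_(j < n) Rmult (a j) (v j).
Proof.
move=> H; apply: is_RInt_unique.
elim: n H => [|n IH] H.
  rewrite big_ord0; apply: (is_RInt_ext (fun=> IZR 0)).
    by move=> th _; rewrite big_ord0.
  have := is_RInt_const u w (IZR 0); rewrite /scal /= /mult /= Rmult_0_r; exact.
rewrite big_ord_recr /=.
apply: (is_RInt_ext (fun th => plus (\big[Rplus/IZR 0]_(j < n) (Rmult (a j) (f j th)))
   (scal (a n) (f n th)))).
  by move=> th _; rewrite big_ord_recr.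
apply: is_RInt_plus; first by apply: IH => j jn; apply: H; rewrite ltnS ltnW.
by apply: is_RInt_scal; apply: H.
Qed.

Section LaurentCoef.

Variables (d m : nat) (beta : seq nat) (r x : R) (k : Z) (t : nat) (Q : {poly R}).
Hypotheses (d_gt0 : (0 < d)%N) (beta_pos : all (fun b => 0 < b)%N beta).
Hypotheses (sum_beta : sumn beta = d).
Hypotheses (tk : Z.of_nat t = Z.add (Z.of_nat (size beta).-1) k).
Hypotheses (eQ : (1 - 'X) * Q = \prod_(b <- beta) (1 - 'X^b)) (szQ : (size Q <= d)%N).
Hypotheses (x_gt0 : Rlt 0 x) (r_gt0 : Rlt 0 r) (r_lt1 : Rlt r 1).
Hypothesis (xr : Rlt (Rabs (ln x)) r).

Local Open Scope R_scope.
Let a j := (INR d - 1) / 2 - INR j.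
Let c j := nth 0 Q j / INR (\prod_(b <- beta) b) * pwlog (INR d - 1 - INR j) m x * / r ^ t.

(** The j-th circle integral is proportional to (a_j r)^t / t!, so r^t cancels and the coefficient
    does not depend on r. *)
Lemma laurent_coef_ReE : laurent_coef_Re d m beta r k x =
  \big[Rplus/0]_(j < d) (nth 0 Q j / INR (\prod_(b <- beta) b) * (a j ^ t / INR t`!) *
                          pwlog (INR d - 1 - INR j) m x).
Proof.
rewrite /laurent_coef_Re.
rewrite (RInt_ext _ (fun th => \big[Rplus/0]_(j < d) (c j * circ_fun (a j * r) (INR t) 0 th))).
  rewrite (RInt_bigsum c (fun j _ => is_RInt_circ (a j * r) 0 t)).
  rewrite cos_0 big_distrr /=; apply: eq_bigr => j _.
  rewrite /c Rpow_mult_distr; have f0 := INR_fact_neq0 t.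
  have rt : r ^ t <> 0 by apply: pow_nonzero; lra.
  have := PI_neq0 => pi0; set u := nth _ _ _ / _; field; repeat split => //.
move=> th _; rewrite (circ_integrandE m th d_gt0 beta_pos sum_beta tk eQ szQ) //.
rewrite Re_sum; apply: eq_bigr => j _.
by rewrite /Complex.Re /= -/(c j) -/(a j); eqR; ring.
Qed.

Lemma laurent_coef_ImE : laurent_coef_Im d m beta r k x = 0.
Proof.
rewrite /laurent_coef_Im.
rewrite (RInt_ext _ (fun th => \big[Rplus/0]_(j < d)
    (c j * circ_fun (a j * r) (INR t) (- (PI / 2)) th))).
  rewrite (RInt_bigsum c (fun j _ => is_RInt_circ (a j * r) (- (PI / 2)) t)).
  rewrite cos_neg cos_PI2 big1 ?Rmult_0_r // => j _.
  by rewrite /Rdiv; ring.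
move=> th _; rewrite (circ_integrandE m th d_gt0 beta_pos sum_beta tk eQ szQ) //.
rewrite Im_sum; apply: eq_bigr => j _.
by rewrite /Complex.Im /= -/(c j) -/(a j); eqR; ring.
Qed.

End LaurentCoef.

End CircleIntegrand.

(** * The quotient polynomial Q and the eigenvalues over the reals *)

Section CycleQuotient.
Local Open Scope ring_scope.

(** The factor of the first part is already divisible by 1 - X. The size bound ensures that sums
    over k < d exhaust the coefficients of Q. *)
Lemma cycle_quotient (beta : seq nat) :
  all (fun b => 0 < b)%N beta -> (0 < sumn beta)%N ->
  exists2 Q : {poly R}, (1 - 'X) * Q = \prod_(b <- beta) (1 - 'X^b) & (size Q <= sumn beta)%N.
Proof.
move=> pos sb.
have szP (s : seq nat) : leq (size (\prod_(b <- s) (1 - 'X^b) : {poly R})) (sumn s).+1.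
  elim: s => [|b s IH]; first by rewrite big_nil size_poly1.
  rewrite big_cons /=; apply: leq_trans (size_polyMleq _ _) _.
  have : leq (size (1 - 'X^b : {poly R})) b.+1.
    apply: leq_trans (size_polyD _ _) _.
    by rewrite size_polyN size_polyXn size_poly1 geq_max /= leqnn.
  move: IH; move: (size _) (size _) => u v; lia.
case: beta sb pos => // b s sb /= /andP[b0 pos].
have eQ : (1 - 'X) * ((\sum_(i < b) 'X^i) * \prod_(c <- s) (1 - 'X^c)) =
   \prod_(c <- b :: s) (1 - 'X^c) :> {poly R}.
  by rewrite big_cons geom_poly mulrA.
exists ((\sum_(i < b) 'X^i) * \prod_(c <- s) (1 - 'X^c)) => //.
set Q := (X in (size (polyseq X) <= _)%N) in eQ *.
have := szP (b :: s); rewrite -eQ /=.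
have [->|Q0] := eqVneq Q 0; first by rewrite size_poly0.
rewrite size_mul ?poly_1BX_neq0 //.
by rewrite -opprB size_polyN size_XsubC.
Qed.

Lemma eigvalE (d k : nat) : (k < d)%N ->
  (eigval R d k d.-1 = Rmult (INR d) ((INR d - 1) / 2 - INR k)) /\
  forall m, eigval R d k m = nth (IZR 0) (ffpoly (Rminus (Rminus (INR d) 1) (INR k)) d) m.
Proof.
move=> kd; have d0 : (0 < d)%N by lia.
have e : (d - 1 - k)%:R = Rminus (Rminus (INR d) 1) (INR k) :> R.
  by rewrite -INRE !minus_INR //; apply/leP; lia.
split; last by move=> m; rewrite /eigval e.
have := ffpoly_subtop (Rminus (Rminus (INR d) 1) (INR k)) d0.
rewrite /eigval e; set u := _`_d.-1.
have -> : d.-1%:R = Rminus (INR d) 1 :> R by rewrite -INRE -{2}(prednK d0) S_INR; ring.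
rewrite mulr_natl !mulr2n -INRE => h.
have {}h : Rplus u u = Rmult (INR d) (Rminus (Rplus (Rminus (Rminus (INR d) 1) (INR k))
   (Rminus (Rminus (INR d) 1) (INR k))) (Rminus (INR d) 1)) by exact: h.
by change (u = Rmult (INR d) (Rminus (Rdiv (Rminus (INR d) 1) 2) (INR k))); lra.
Qed.

End CycleQuotient.

(** * Comparison of the two sides *)

Local Open Scope R_scope.

(** By [card_class] the prefactor times the class size is the inverse of the product of the parts;
    d^t comes out of the eigenvalues (d a_k)^t. *)
Lemma hurwitz_count_real (d t m : nat) (beta : seq nat) (Q : {poly R}) :
  (0 < d)%N -> all (fun b => 0 < b)%N beta -> sumn beta = d ->
  ((1 - 'X) * Q = \prod_(b <- beta) (1 - 'X^b))%R ->
  INR (Aut beta) / INR d`! * INR (hurwitz_count d t m beta) =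
  INR d ^ t / INR d / INR (\prod_(b <- beta) b) *
  \big[Rplus/0]_(k < d) (nth 0 Q k * ((INR d - 1) / 2 - INR k) ^ t *
     nth 0 (ffpoly (Rminus (Rminus (INR d) 1) (INR k)) d) m).
Proof.
move=> d0 pos sb eQ.
have := hurwitz_countE d0 t m sb eQ; rewrite -!INRE.
set S := (X in _ = (_ * X)%R -> _) => h.
have {}h : INR d * INR (hurwitz_count d t m beta) =
   INR #|[set s : {perm 'I_d} | has_cycle_type s beta]| * S by exact: h.
have eS : S = INR d ^ t * \big[Rplus/0]_(k < d) (nth 0 Q k * ((INR d - 1) / 2 - INR k) ^ t *
     nth 0 (ffpoly (Rminus (Rminus (INR d) 1) (INR k)) d) m).
  rewrite /S big_distrr /=; apply: eq_bigr => k _.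
  have [-> ->] := eigvalE (ltn_ord k); rewrite -RpowE Rpow_mult_distr.
  by set u := nth _ Q k; set v := nth _ _ m; set w := _ - _; rewrite -!RmultE; ring.
have := card_class pos sb; set c := #|_| in h *; set B := (\prod_(b <- beta) b)%N.
move=> cB; rewrite -cB !mult_INR.
have fd : INR d`! <> 0 by apply: INR_fact_neq0.
rewrite -cB !mult_INR in fd.
have dn : INR d <> 0 by apply: not_0_INR; lia.
have [c0 [B0 A0]] : INR c <> 0 /\ INR B <> 0 /\ INR (Aut beta) <> 0.
  by split; [|split] => e; case: fd; rewrite e; ring.
have eN : INR (hurwitz_count d t m beta) = INR c * S / INR d.
  by rewrite -h; field.
rewrite eN eS; move: (\big[Rplus/0]_(k < d) _) => s.
by field; repeat split.
Qed.

Lemma locally_ln_small r : 0 < r -> locally 1 (fun x => 0 < x /\ Rabs (ln x) < r).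
Proof.
move=> r0.
have h1 : locally 1 (fun x => exp (- r) < x).
  by apply: open_gt; rewrite -exp_0; apply: exp_increasing; lra.
have h2 : locally 1 (fun x => x < exp r).
  by apply: open_lt; rewrite -exp_0; apply: exp_increasing; lra.
apply: filter_imp (filter_and _ _ h1 h2) => x [x1 x2].
have x0 : 0 < x by have := exp_pos (- r); lra.
split => //; apply: Rabs_def1; first by rewrite -(ln_exp r); apply: ln_increasing.
by rewrite -(ln_exp (- r)); apply: ln_increasing => //; apply: exp_pos.
Qed.

Unset Implicit Arguments.

(* ssrint rebinds the key to int_scope. *)
Delimit Scope Z_scope with Z.

Theorem theorem3p3 (g m d : nat) (beta : seq nat) :
  (0 < m)%N -> (0 < d)%N ->
  all (fun b => 0 < b)%N beta -> sumn beta = d ->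
  (d + 1 <= 2 * g + size beta + m)%N ->
  let t := (2 * g + size beta + m - 1 - d)%N in
  let k := (2 * Z.of_nat g + Z.of_nat m - Z.of_nat d)%Z in
  exists r0 : R, 0 < r0 /\
    forall r : R, 0 < r < r0 ->
      ex_derive_n (laurent_coef_Re d m beta r k) d 1 /\
      ex_derive_n (laurent_coef_Im d m beta r k) d 1 /\
      Derive_n (laurent_coef_Im d m beta r k) d 1 = 0 /\
      hurwitzH g d m beta =
        INR (t`!) * powerRZ (INR d) (Z.of_nat t - 1)
        * Derive_n (laurent_coef_Re d m beta r k) d 1.
Proof.
move=> _ d0 pos sb hle t k.
have [Q eQ szQ] : exists2 Q : {poly R},
    ((1 - 'X) * Q = \prod_(b <- beta) (1 - 'X^b))%R & (size Q <= d)%N.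
  by rewrite -sb; apply: cycle_quotient => //; rewrite sb.
have n0 : (0 < size beta)%N by case: (beta) sb d0 => //= <-.
(* The power y^(n - 1) in the denominator shifts the index k, possibly negative, to t >= 0. *)
have tk : Z.of_nat t = Z.add (Z.of_nat (size beta).-1) k by rewrite /t /k; lia.
exists 1; split; first by lra.
move=> r [r0 r1].
pose B := (\prod_(b <- beta) b)%N.
pose a j := nth 0 Q j / INR B * (((INR d - 1) / 2 - INR j) ^ t / INR t`!).
pose F x := \big[Rplus/0]_(j < d) (a j * pwlog (INR d - 1 - INR j) m x).
(* The formula holds where |log x| < r, a neighbourhood of 1, which suffices for derivatives at
   1. *)
have locF : locally 1 (fun x => F x = laurent_coef_Re d m beta r k x).
  apply: filter_imp (locally_ln_small r0) => x [x0 xr].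
  by rewrite (laurent_coef_ReE m d0 pos sb tk eQ szQ x0 r0 r1 xr).
have loc0 : locally 1 (fun x => 0 = laurent_coef_Im d m beta r k x).
  apply: filter_imp (locally_ln_small r0) => x [x0 xr].
  by rewrite (laurent_coef_ImE m d0 pos sb tk eQ szQ x0 r0 r1 xr).
have [exF DF] := @Derive_n_pwlog_sum d a (fun j => INR d - 1 - INR j) m d.
split; first exact: ex_derive_n_ext_loc locF exF.
split; first by apply: ex_derive_n_ext_loc loc0 _; apply: ex_derive_n_const.
split.
  rewrite -(Derive_n_ext_loc _ _ d 1 loc0).
  by rewrite -(prednK d0) Derive_n_const.
rewrite -(Derive_n_ext_loc _ _ d 1 locF) DF.
have dn : INR d <> 0 by apply: not_0_INR; lia.
have -> : powerRZ (INR d) (Z.of_nat t - 1) = INR d ^ t / INR d.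
  by rewrite /Zminus powerRZ_add // -pow_powerRZ /= Rmult_1_r.
rewrite /hurwitzH -/t (hurwitz_count_real t m d0 pos sb eQ) -/B.
rewrite !big_distrr /=; apply: eq_bigr => j _; rewrite /a.
have t0 : INR t`! <> 0 by apply: INR_fact_neq0.
rewrite /Rdiv; move: (/ INR B) => iB; field; split => //.
Qed.
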